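(* Let $G(z)=\sum_{p=0}^{d}z^pA_p+\sum_{j=1}^k w_j(z)E_j$ be an $n\times n$ T-odd rational matrix polynomial and let $\lambda\in\mathbb{C}\setminus\{0\}$ be such that $\lambda$ is not a pole of $G(z)$ and $w_j(\lambda)\ne0$ for $j=1,\ldots,k$. Suppose that $M:=(G(\lambda))^{-1}$ exists. Let $m:=\lfloor\frac{d}{2}\rfloor$, let $r$ be the number of indices $j\in\{1,\ldots,k\}$ for which $w_j$ is an odd function, and let $X_e=\{p_{r+1}<\cdots<p_k\}$ be the set of indices $j\in\{1,\ldots,k\}$ for which $w_j$ is an even function. Put $N:=m+k-r$, $$\Lambda:=[1,\lambda,\ldots,\lambda^d,w_1(\lambda),\ldots,w_k(\lambda)]\in\mathbb{C}^{1\times(d+k+1)},\qquad J:=\Lambda^*\Lambda\otimes M^*M,$$ $$C_j:=\begin{cases}\Lambda^Te_{2j+1}^T\otimes M^T,& j=0,\ldots,m,\\ \Lambda^Te_{d+1+p_{j-m+r}}^T\otimes M^T,& j=m+1,\ldots,N,\end{cases}\qquad S_j:=C_j+C_j^T,$$ where $e_i$ is the $i$th standard unit vector of $\mathbb{R}^{d+k+1}$. Define $\psi:\mathbb{R}^{2N+1}\to\mathbb{R}$ by $\psi(t_0,\ldots,t_{2N}):=\lambda_2(F(t_0,\ldots,t_{2N}))$, where $$F(t_0,\ldots,t_{2N}):=\begin{bmatrix}J&\overline{f}\\ f&\overline{J}\end{bmatrix},\qquad f:=(t_0+it_1)S_0+\cdots+(t_{2N-2}+it_{2N-1})S_{N-1}+t_{2N}S_{N}.$$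 Then: (1) The function $\psi$ has a global minimum $\widehat\lambda_2:=\min_{(t_0,\ldots,t_{2N})\in\mathbb{R}^{2N+1}}\psi(t_0,\ldots,t_{2N})$, and $\eta^{\mathrm{odd}_T}(G,\lambda)\ge\frac{1}{\sqrt{\widehat\lambda_2}}$. (2) Moreover, if the minimum $\widehat\lambda_2$ of $\psi$ is attained at $(\hat t_0,\ldots,\hat t_{2N})\in\mathbb{R}^{2N+1}$ and is a simple eigenvalue of $F(\hat t_0,\ldots,\hat t_{2N})$, then $\eta^{\mathrm{odd}_T}(G,\lambda)=\frac{1}{\sqrt{\widehat\lambda_2}}$.
   Context: A rational matrix polynomial (RMP) is $G(z)=\sum_{p=0}^d z^pA_p+\sum_{j=1}^k w_j(z)E_j$ with $A_p,E_j\in\mathbb{C}^{n\times n}$ and $w_j(z)=s_j(z)/q_j(z)$, where $s_j,q_j$ are scalar polynomials, $q_j\not\equiv0$. The poles of $G(z)$ are the roots of the $q_j$. $G(z)$ is T-odd if every $w_j$ is either an even or an odd function, $A_p^T=(-1)^{p+1}A_p$ for $p=0,\ldots,d$, $E_j^T=E_j$ whenever $w_j$ is odd, and $E_j^T=-E_j$ whenever $w_j$ is even (so $G(z)^T=-G(-z)$). $\|\cdot\|$ is the spectral norm. For a tuple of $n\times n$ matrices, the tuple norm is $$|||(\Delta A_0,\ldots,\Delta A_d,\Delta E_1,\ldots,\Delta E_k)|||:=\sqrt{\textstyle\sum_{p=0}^d\|\Delta A_p\|^2+\sum_{j=1}^k\|\Delta E_j\|^2}.$$ For $\mathbb{S}\subseteq(\mathbb{C}^{n\times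 n})^{d+k+1}$ the structured eigenvalue backward error $\eta^{\mathbb{S}}(G,\lambda)$ is the infimum of $|||(\Delta A_0,\ldots,\Delta E_k)|||$ over all $(\Delta A_0,\ldots,\Delta A_d,\Delta E_1,\ldots,\Delta E_k)\in\mathbb{S}$ with $$\det\Big(\sum_{p=0}^d\lambda^p(A_p-\Delta A_p)+\sum_{j=1}^kw_j(\lambda)(E_j-\Delta E_j)\Big)=0.$$ $\eta^{\mathrm{odd}_T}(G,\lambda)$ denotes $\eta^{\mathbb{S}}(G,\lambda)$ when $\mathbb{S}$ is the set of tuples with $\Delta A_p^T=(-1)^{p+1}\Delta A_p$ for $p=0,\ldots,d$, $\Delta E_j^T=\Delta E_j$ if $w_j$ is odd, and $\Delta E_j^T=-\Delta E_j$ if $w_j$ is even. $\lambda_2(H)$ is the second largest eigenvalue (counted with multiplicity) of a Hermitian matrix $H$; $\overline{X}$ is the entrywise complex conjugate; $\otimes$ is the Kronecker product. *)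

(* Defs.v *)
From HB Require Import structures.
From mathcomp Require Import all_boot all_order all_algebra.
From mathcomp Require Import complex mxtens.
From mathcomp Require Import boolp classical_sets reals constructive_ereal ereal.

Set Implicit Arguments.
Unset Strict Implicit.
Unset Printing Implicit Defensive.

Import Order.TTheory GRing.Theory Num.Theory.
Local Open Scope ring_scope.
Local Open Scope complex_scope.

(* Coefficient tuples (A_0, .., A_d, E_1, .., E_k); 'I_k is 0-based, so its
   element j stands for the index j + 1. *)
Definition coefs (R : realType) (n d k : nat) : Type :=
  (('I_d.+1 -> 'M[R[i]]_n) * ('I_k -> 'M[R[i]]_n))%type.

Record rmp (R : realType) (n d k : nat) := RMP {
  rmp_coefs : coefs R n d k ;
  rmp_num : 'I_k -> {poly R[i]} ;
  rmp_den : 'I_k -> {poly R[i]} ;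
  rmp_den_neq0 : forall j, rmp_den j != 0
}.

Section MatrixNotions.
Variable R : realType.
Local Notation C := R[i].

Definition vnorm (n : nat) (x : 'cV[C]_n) : R :=
  Num.sqrt (\sum_i Normc.normc (x i 0) ^+ 2).

Definition spectral_norm (n : nat) (A : 'M[C]_n) : R :=
  sup [set vnorm (A *m x) | x in [set x : 'cV[C]_n | vnorm x = 1]]%classic.

Definition tuple_norm (n d k : nat) (D : coefs R n d k) : R :=
  Num.sqrt (\sum_(p < d.+1) spectral_norm (D.1 p) ^+ 2
            + \sum_(j < k) spectral_norm (D.2 j) ^+ 2).

Definition eigenvalues (n : nat) (H : 'M[C]_n) : seq C :=
  sval (closed_field_poly_normal (char_poly H)).

(* Meant for Hermitian H, whose eigenvalues are real: complex.Re is then only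
   a cast to R. *)
Definition lambda2 (n : nat) (H : 'M[C]_n) : R :=
  nth 0 (sort (fun x y : R => y <= x) [seq complex.Re z | z <- eigenvalues H]) 1.

Definition simple_eigenvalue (n : nat) (H : 'M[C]_n) (a : C) : Prop :=
  mup a (char_poly H) = 1%N.

Definition conjmx (m n : nat) (A : 'M[C]_(m, n)) : 'M[C]_(m, n) :=
  map_mx (@conjc R) A.

Definition adjmx (m n : nat) (A : 'M[C]_(m, n)) : 'M[C]_(n, m) :=
  (conjmx A)^T.

End MatrixNotions.

Section RationalMatrixPolynomials.
Variables (R : realType) (n d k : nat) (G : rmp R n d k).
Local Notation C := R[i].

Definition weight (j : 'I_k) (z : C) : C :=
  (rmp_num G j).[z] / (rmp_den G j).[z].

Definition is_pole (z : C) : Prop := exists j, root (rmp_den G j) z.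

Definition weighted_sum (D : coefs R n d k) (z : C) : 'M[C]_n :=
  \sum_(p < d.+1) z ^+ p *: D.1 p + \sum_(j < k) weight j z *: D.2 j.

Definition rmp_eval (z : C) : 'M[C]_n := weighted_sum (rmp_coefs G) z.

(* Parity of w_j as a rational function, tested wherever both w_j(z) and
   w_j(-z) are defined. *)
Definition weight_even (j : 'I_k) : Prop :=
  forall z, ~~ root (rmp_den G j) z -> ~~ root (rmp_den G j) (- z) ->
    weight j (- z) = weight j z.

Definition weight_odd (j : 'I_k) : Prop :=
  forall z, ~~ root (rmp_den G j) z -> ~~ root (rmp_den G j) (- z) ->
    weight j (- z) = - weight j z.

Definition oddT_set : set (coefs R n d k) :=
  [set D | [/\ forall p : 'I_d.+1, (D.1 p)^T = (-1) ^+ p.+1 *: D.1 p,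
               forall j, weight_odd j -> (D.2 j)^T = D.2 j
             & forall j, weight_even j -> (D.2 j)^T = - D.2 j]]%classic.

Definition T_odd : Prop :=
  (forall j, weight_even j \/ weight_odd j) /\ oddT_set (rmp_coefs G).

Definition coefs_sub (D D' : coefs R n d k) : coefs R n d k :=
  (fun p => D.1 p - D'.1 p, fun j => D.2 j - D'.2 j).

(* Extended-real valued, so that the infimum of the empty set is +oo. *)
Definition backward_error (S : set (coefs R n d k)) (l : C) : \bar R :=
  ereal_inf [set (tuple_norm D)%:E | D in
    [set D | S D /\ \det (weighted_sum (coefs_sub (rmp_coefs G) D) l) = 0]]%classic.

Definition eta_oddT (l : C) : \bar R := backward_error oddT_set l.

Definition half_deg : nat := d./2.

Definition num_odd : nat := #|[set j : 'I_k | `[< weight_odd j >]]|.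

(* The indices p_{r+1} < ... < p_k, 1-based and increasing. *)
Definition even_indices : seq nat :=
  [seq (val j).+1 | j <- enum [set j : 'I_k | `[< weight_even j >]]].

Definition even_index (l : nat) : nat := nth 0%N even_indices (l - num_odd.+1).

Definition bigN : nat := half_deg + k - num_odd.

Definition Lambda (l : C) : 'rV[C]_(d.+1 + k) :=
  row_mx (\row_(p < d.+1) l ^+ p) (\row_(j < k) weight j l).

(* Standard unit vectors, with the 1-based index i. *)
Definition unit_vec (i : nat) : 'cV[C]_(d.+1 + k) :=
  \col_(s < d.+1 + k) (s.+1 == i)%:R.

Definition Mmx (l : C) : 'M[C]_n := invmx (rmp_eval l).

Definition Jmx (l : C) : 'M[C]_((d.+1 + k) * n) :=
  (adjmx (Lambda l) *m Lambda l) *t (adjmx (Mmx l) *m Mmx l).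

Definition Cmx (l : C) (j : nat) : 'M[C]_((d.+1 + k) * n) :=
  if (j <= half_deg)%N
  then ((Lambda l)^T *m (unit_vec (2 * j + 1))^T) *t (Mmx l)^T
  else ((Lambda l)^T *m
        (unit_vec (d + 1 + even_index (j - half_deg + num_odd)))^T) *t (Mmx l)^T.

Definition Smx (l : C) (j : nat) : 'M[C]_((d.+1 + k) * n) :=
  Cmx l j + (Cmx l j)^T.

Definition fmx (l : C) (t : 'I_(2 * bigN).+1 -> R) : 'M[C]_((d.+1 + k) * n) :=
  \sum_(0 <= j < bigN)
     (t (inord (2 * j)) +i* t (inord (2 * j + 1))) *: Smx l j
  + (t (inord (2 * bigN)))%:C *: Smx l bigN.

Definition Fmx (l : C) (t : 'I_(2 * bigN).+1 -> R) :
    'M[C]_((d.+1 + k) * n + (d.+1 + k) * n) :=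
  block_mx (Jmx l) (conjmx (fmx l t)) (fmx l t) (conjmx (Jmx l)).

Definition psi (l : C) (t : 'I_(2 * bigN).+1 -> R) : R := lambda2 (Fmx l t).

End RationalMatrixPolynomials.

(* Main.v *)
Require Import Defs.
From HB Require Import structures.
From mathcomp Require Import all_boot all_order all_algebra.
From mathcomp Require Import complex mxtens.
From mathcomp Require Import boolp classical_sets reals constructive_ereal ereal.
From mathcomp Require Import perm spectral sesquilinear.
From mathcomp Require Import topology normedtype derive.
From mathcomp Require Import ring lra zify.

(** Write [L] for the row [Lambda], [M] for the inverse of [G(lam)], and let the
entry [i] of a coefficient tuple be any of the [A_p] and [E_j].

Reduction to vectors. The perturbed matrix is singular exactly when some
[x <> 0] satisfies [sum_i L_i Delta_i x = G(lam) x]. Only the products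
[v_i = Delta_i x] enter this equation: stacking them into one column [v], it
says [x = M (sum_i L_i v_i)], that is [x = B v] with [B = solve_mx]. A skew
[Delta_i] forces [x^T v_i = 0]. Conversely, for every [v] with these relations
([feasible]) and [x = B v <> 0] there are structured [Delta_i] with
[Delta_i x = v_i] and spectral norm at most [|v_i| / |x|] ([skew_mapping], [sym_mapping]). Hence the backward error is
the infimum of [|v| / |B v|] over feasible [v] with [B v <> 0].

Lower bound. The Hermitian form of [F] at the column with blocks [a] and the
conjugate of [b] is
[|B a|^2 + |B b|^2 + 2 Re (sum_j z_j (Bb.E_j a + E_j b.Ba))] ([qf_pencil]), where
the [z_j] are the coefficients of [f]. If [v] is feasible then the last sum
vanishes on the plane [a = alpha v], [b = beta v], so that the form is
[|B v|^2 / |v|^2] times the squared norm there; the min-max principle gives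
[feasible_le]. The tuple [G] itself is an admissible perturbation, which
provides a feasible [v] and makes the bound positive.

Existence of the minimum. All [z_j] are taken complex; multiplying [z] by a
phase amounts to a unitary change of basis ([pencil_rotate]), so that
restricting the last coefficient to real values loses nothing. In a direction
[z_j] the second eigenvalue grows at least linearly once some coordinate is
pinned to [0] ([pencil_coercive]). Pinning costs nothing: either some
coefficient is not skew, or all are, [M] is skew, and the [S_j] satisfy the
linear relation of [pencil_shift]. The second eigenvalue is Lipschitz in [z],
whence a minimum on a large box ([pencil_min]).

Equality. At a minimum with a simple second eigenvalue, a first-order decrease
in some direction would lower that eigenvalue ([simple_lambda2]), so the
derivative of the form at the eigenvector vanishes in all complex directions
[z_j]. Exchanging and conjugating the two blocks preserves the eigenspace, so
the eigenvector has blocks [a] and the conjugate of [c a] with [|c| = 1];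
stationarity then says that [a] is feasible and the eigenvalue equation that
[|B a|^2 = lhat |a|^2] ([optimal_feasible]). *)

Import Order.TTheory GRing.Theory Num.Theory.
Import numFieldNormedType.Exports.
Local Open Scope ring_scope.
Local Open Scope complex_scope.

Set Implicit Arguments.
Unset Strict Implicit.
Unset Printing Implicit Defensive.

Local Notation cmx := Defs.conjmx.
Local Notation "x ^*" := (conjc x) : ring_scope.

(** * Complex columns: bilinear product, Hermitian form, squared norm *)

Section Vectors.
Variable R : realType.
Local Notation C := R[i].

(** Bilinear, without conjugation: the Hermitian product of [x] and [y] is
[dot (cmx x) y]. *)
Definition dot n (x y : 'cV[C]_n) : C := (x^T *m y) 0 0.
Definition qf n (H : 'M[C]_n) (y : 'cV[C]_n) : R := complex.Re (dot (cmx y) (H *m y)).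
Definition sqn n (y : 'cV[C]_n) : R := complex.Re (dot (cmx y) y).
Definition nsq (c : C) : R := complex.Re (c^* * c).

Lemma conjM (a b : C) : (a * b)^* = a^* * b^*.
Proof. exact: rmorphM. Qed.

Lemma conjD (a b : C) : (a + b)^* = a^* + b^*.
Proof. exact: rmorphD. Qed.

Lemma conj_sum (I : finType) (f : I -> C) : (\sum_i f i)^* = \sum_i (f i)^*.
Proof. exact: rmorph_sum. Qed.

Lemma conjR (r : R) : (r%:C)^* = r%:C.
Proof. exact: conjc_real. Qed.

Lemma dotE n (x y : 'cV[C]_n) : dot x y = \sum_i x i 0 * y i 0.
Proof. by rewrite /dot mxE; apply: eq_bigr => i _; rewrite mxE. Qed.

Lemma dotC n (x y : 'cV[C]_n) : dot x y = dot y x.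
Proof. by rewrite !dotE; apply: eq_bigr => i _; rewrite mulrC. Qed.

Lemma dotDr n (x y z : 'cV[C]_n) : dot x (y + z) = dot x y + dot x z.
Proof. by rewrite /dot mulmxDr mxE. Qed.

Lemma dotDl n (x y z : 'cV[C]_n) : dot (y + z) x = dot y x + dot z x.
Proof. by rewrite dotC dotDr !(dotC x). Qed.

Lemma dotZr n c (x y : 'cV[C]_n) : dot x (c *: y) = c * dot x y.
Proof. by rewrite /dot -scalemxAr mxE. Qed.

Lemma dotZl n c (x y : 'cV[C]_n) : dot (c *: x) y = c * dot x y.
Proof. by rewrite dotC dotZr dotC. Qed.

Lemma dotNr n (x y : 'cV[C]_n) : dot x (- y) = - dot x y.
Proof. by rewrite -scaleN1r dotZr mulN1r. Qed.

Lemma dotNl n (x y : 'cV[C]_n) : dot (- x) y = - dot x y.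
Proof. by rewrite dotC dotNr dotC. Qed.

Lemma dot0r n (x : 'cV[C]_n) : dot x 0 = 0.
Proof. by rewrite /dot mulmx0 mxE. Qed.

Lemma dot0l n (x : 'cV[C]_n) : dot 0 x = 0.
Proof. by rewrite dotC dot0r. Qed.

Lemma dot_sumr n (I : finType) (x : 'cV[C]_n) (F : I -> 'cV[C]_n) :
  dot x (\sum_i F i) = \sum_i dot x (F i).
Proof. by rewrite /dot mulmx_sumr summxE. Qed.

Lemma dot_mulmx m n (A : 'M[C]_(m, n)) x y : dot x (A *m y) = dot (A^T *m x) y.
Proof. by rewrite /dot mulmxA trmx_mul trmxK. Qed.

Lemma rank1_mulmx n (x y a : 'cV[C]_n) : x *m y^T *m a = dot y a *: x.
Proof.
rewrite -mulmxA; apply/matrixP => i j.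
by rewrite !mxE big_ord1 (ord1 j) mulrC -/(dot _ _).
Qed.

Lemma cmxK m n : involutive (@cmx R m n).
Proof. by move=> A; apply/matrixP => i j; rewrite !mxE conjcK. Qed.

Lemma cmxM m n p (A : 'M[C]_(m, n)) (B : 'M[C]_(n, p)) :
  cmx (A *m B) = cmx A *m cmx B.
Proof. exact: map_mxM. Qed.

Lemma cmxD m n (A B : 'M[C]_(m, n)) : cmx (A + B) = cmx A + cmx B.
Proof. exact: map_mxD. Qed.

Lemma cmxN m n (A : 'M[C]_(m, n)) : cmx (- A) = - cmx A.
Proof. exact: map_mxN. Qed.

Lemma cmxZ m n c (A : 'M[C]_(m, n)) : cmx (c *: A) = c^* *: cmx A.
Proof. exact: map_mxZ. Qed.

Lemma cmx0 m n : cmx (0 : 'M[C]_(m, n)) = 0.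
Proof. exact: map_mx0. Qed.

Lemma cmx_tr m n (A : 'M[C]_(m, n)) : cmx A^T = (cmx A)^T.
Proof. exact/esym/map_trmx. Qed.

Lemma conj_dot n (x y : 'cV[C]_n) : (dot x y)^* = dot (cmx x) (cmx y).
Proof.
rewrite !dotE rmorph_sum; apply: eq_bigr => i _.
by rewrite !mxE rmorphM.
Qed.

Lemma ReD (a b : C) : complex.Re (a + b) = complex.Re a + complex.Re b.
Proof. exact: raddfD. Qed.
Lemma ReN (a : C) : complex.Re (- a) = - complex.Re a.
Proof. exact: raddfN. Qed.
Lemma Re_sum (I : finType) (F : I -> C) :
  complex.Re (\sum_i F i) = \sum_i complex.Re (F i).
Proof. exact: raddf_sum. Qed.
Lemma ReJ (a : C) : complex.Re (a^*) = complex.Re a.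
Proof. by case: a. Qed.
Lemma ReZ (r : R) (a : C) : complex.Re (r%:C * a) = r * complex.Re a.
Proof. by case: a => x y /=; rewrite mul0r subr0. Qed.

Lemma nsqE (c : C) : (nsq c)%:C = c^* * c.
Proof.
by case: c => a b; apply/eqP; rewrite eq_complex /= eqxx /=; apply/eqP; ring.
Qed.

Lemma nsqEn (c : C) : nsq c = Normc.normc c ^+ 2.
Proof.
case: c => a b; rewrite /nsq /= sqr_sqrtr ?addr_ge0 ?sqr_ge0 //; ring.
Qed.

Lemma nsq_ge0 c : 0 <= nsq c. Proof. by rewrite nsqEn sqr_ge0. Qed.

Lemma nsq_eq0 c : (nsq c == 0) = (c == 0).
Proof.
rewrite nsqEn expf_eq0 /=; apply/eqP/eqP => [/Normc.eq0_normc//|->].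
exact: Normc.normc0.
Qed.

Lemma nsq0 : nsq 0 = 0. Proof. by apply/eqP; rewrite nsq_eq0. Qed.

Lemma nsqN a : nsq (- a) = nsq a.
Proof. by case: a => x y; rewrite /nsq /=; ring. Qed.

Lemma nsqM a b : nsq (a * b) = nsq a * nsq b.
Proof. by rewrite !nsqEn Normc.normcM exprMn. Qed.

Lemma nsqJ a : nsq a^* = nsq a.
Proof. by rewrite /nsq conjcK mulrC. Qed.

Lemma nsq_real (r : R) : nsq r%:C = r ^+ 2.
Proof. by rewrite /nsq /=; ring. Qed.

Lemma sqn_sum n (y : 'cV[C]_n) : sqn y = \sum_i nsq (y i 0).
Proof.
by rewrite /sqn dotE Re_sum; apply: eq_bigr => i _; rewrite mxE.
Qed.

Lemma sqnE n (y : 'cV[C]_n) : (sqn y)%:C = dot (cmx y) y.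
Proof.
rewrite sqn_sum dotE rmorph_sum; apply: eq_bigr => i _.
by rewrite mxE -nsqE.
Qed.

Lemma sqn_ge0 n (y : 'cV[C]_n) : 0 <= sqn y.
Proof. by rewrite sqn_sum sumr_ge0 // => i _; apply: nsq_ge0. Qed.

Lemma sqn_eq0 n (y : 'cV[C]_n) : (sqn y == 0) = (y == 0).
Proof.
apply/idP/idP => [|/eqP ->]; last by rewrite /sqn dot0r.
rewrite sqn_sum psumr_eq0; last by move=> i _; apply: nsq_ge0.
move=> /allP h; apply/eqP/matrixP => i j; rewrite (ord1 j) mxE.
by apply/eqP; rewrite -nsq_eq0; apply: h; rewrite mem_index_enum.
Qed.

Lemma sqn_gt0 n (y : 'cV[C]_n) : (0 < sqn y) = (y != 0).
Proof. by rewrite lt_def sqn_eq0 sqn_ge0 andbT. Qed.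

Lemma sqn0 n : sqn (0 : 'cV[C]_n) = 0.
Proof. by apply/eqP; rewrite sqn_eq0. Qed.

Lemma sqnJ n (y : 'cV[C]_n) : sqn (cmx y) = sqn y.
Proof. by rewrite /sqn cmxK dotC. Qed.

Lemma sqnZ n c (y : 'cV[C]_n) : sqn (c *: y) = nsq c * sqn y.
Proof.
rewrite !sqn_sum mulr_sumr; apply: eq_bigr => i _.
by rewrite mxE nsqM.
Qed.

Lemma sqnD n (x y : 'cV[C]_n) :
  sqn (x + y) = sqn x + sqn y + 2 * complex.Re (dot (cmx x) y).
Proof.
have e : complex.Re (dot (cmx x) y) = complex.Re (dot (cmx y) x).
  by rewrite -ReJ conj_dot cmxK dotC.
by rewrite /sqn cmxD !(dotDl, dotDr) !ReD e; ring.
Qed.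

Lemma sqnN n (y : 'cV[C]_n) : sqn (- y) = sqn y.
Proof. by rewrite -scaleN1r sqnZ /nsq; rewrite rmorphN1 mulrNN mul1r mul1r. Qed.

Lemma sqn_col_mx m n (a : 'cV[C]_m) (b : 'cV[C]_n) :
  sqn (col_mx a b) = sqn a + sqn b.
Proof.
rewrite !sqn_sum big_split_ord /=; congr (_ + _); apply: eq_bigr => i _.
  by rewrite col_mxEu.
by rewrite col_mxEd.
Qed.

Lemma vnormE n (y : 'cV[C]_n) : vnorm y = Num.sqrt (sqn y).
Proof.
by rewrite /vnorm sqn_sum; congr Num.sqrt; apply: eq_bigr => i _; rewrite nsqEn.
Qed.

Lemma vnorm_sqr n (y : 'cV[C]_n) : vnorm y ^+ 2 = sqn y.
Proof. by rewrite vnormE sqr_sqrtr ?sqn_ge0. Qed.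

Lemma qf_eigen n (H : 'M[C]_n) (l : R) y : H *m y = l%:C *: y -> qf H y = l * sqn y.
Proof. by move=> e; rewrite /qf e dotZr ReZ. Qed.

Lemma qfZ n (H : 'M[C]_n) c y : qf H (c *: y) = nsq c * qf H y.
Proof.
by rewrite /qf cmxZ -scalemxAr dotZl dotZr mulrA -nsqE ReZ.
Qed.

Lemma qfD n (H K : 'M[C]_n) y : qf (H + K) y = qf H y + qf K y.
Proof. by rewrite /qf mulmxDl dotDr ReD. Qed.

Lemma qfZl n (H : 'M[C]_n) (r : R) y : qf (r%:C *: H) y = r * qf H y.
Proof. by rewrite /qf -scalemxAl dotZr ReZ. Qed.

Lemma sqn_orth n (x y : 'cV[C]_n) :
  dot (cmx x) y = 0 -> sqn (x + y) = sqn x + sqn y.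
Proof. by move=> e; rewrite sqnD e /= mulr0 addr0. Qed.

Lemma invrC (r : R) : (r%:C)^-1 = (r^-1)%:C.
Proof. by apply/esym; apply: (@fmorphV _ _ (real_complex R)). Qed.

(** Division by zero yields [0], so that [p] or [q] may vanish: Bessel's
inequality then degenerates to Cauchy-Schwarz or to positivity. *)
Lemma bessel n (p q a : 'cV[C]_n) : dot (cmx p) q = 0 ->
  nsq (dot (cmx p) a) / sqn p + nsq (dot (cmx q) a) / sqn q <= sqn a.
Proof.
move=> pq.
have qp : dot (cmx q) p = 0.
  by rewrite -[dot _ _]conjcK conj_dot cmxK dotC pq rmorph0.
set al := dot (cmx p) a / (sqn p)%:C; set be := dot (cmx q) a / (sqn q)%:C.
set z := al *: p + be *: q.
have e x c : c = dot (cmx x) a / (sqn x)%:C ->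
    nsq (dot (cmx x) a) / sqn x = nsq c * sqn x /\
    c^* * dot (cmx x) a = (nsq c * sqn x)%:C.
  move=> ->; have [->|nz] := eqVneq x 0.
    by rewrite cmx0 dot0l sqn0 !mul0r invr0 rmorph0 !mulr0.
  have sx : sqn x != 0 by rewrite sqn_eq0.
  rewrite invrC nsqM nsq_real; set t := dot _ a.
  split; first by field.
  rewrite conjM conjR mulrAC -nsqE -!rmorphM; congr (_%:C).
  by field.
have [e1 e1'] := e p al erefl; have [e2 e2'] := e q be erefl.
(* [z] is the orthogonal projection of [a] on the span of [p] and [q]. *)
have sz : sqn z = nsq al * sqn p + nsq be * sqn q.
  by rewrite sqn_orth ?sqnZ // cmxZ dotZl dotZr pq !mulr0.
have cz : dot (cmx z) a = (sqn z)%:C.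
  by rewrite cmxD !cmxZ dotDl !dotZl e1' e2' sz rmorphD.
have := sqn_ge0 (a - z); rewrite addrC sqnD sqnN cmxN dotNl cz ReN /= e1 e2 -sz.
lra.
Qed.

Lemma cauchy_schwarz n (p a : 'cV[C]_n) : nsq (dot (cmx p) a) <= sqn p * sqn a.
Proof.
have [->|nz] := eqVneq p 0.
  by rewrite cmx0 dot0l /nsq mulr0 sqn0 mul0r.
have := @bessel n p 0 a (dot0r _).
by rewrite cmx0 dot0l sqn0 invr0 mulr0 addr0 ler_pdivrMr ?sqn_gt0 // mulrC.
Qed.

Lemma normc_ge0 (c : C) : 0 <= Normc.normc c.
Proof. by case: c => ? ?; apply: sqrtr_ge0. Qed.

Lemma normc_gt0 (c : C) : (0 < Normc.normc c) = (c != 0).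
Proof.
rewrite lt_def normc_ge0 andbT; congr (~~ _).
by apply/eqP/eqP => [/Normc.eq0_normc //|->]; apply: Normc.normc0.
Qed.

Lemma normc_nsq (c : C) (r : R) : 0 <= r -> nsq c <= r ^+ 2 -> Normc.normc c <= r.
Proof.
move=> r0; rewrite nsqEn ler_sqr ?nnegrE //.
exact: normc_ge0.
Qed.

Lemma normc_dot m (x y : 'cV[C]_m) : Normc.normc (dot x y) <= sqn x + sqn y.
Proof.
apply: normc_nsq; first by rewrite addr_ge0 ?sqn_ge0.
have := @cauchy_schwarz _ (cmx x) y; rewrite cmxK sqnJ.
have := sqn_ge0 x; have := sqn_ge0 y; nra.
Qed.

Lemma Re_mul_le (a b : C) : complex.Re (a * b) <= Normc.normc a * Normc.normc b.
Proof.
rewrite -Normc.normcM; case: (a * b) => x y /=.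
by rewrite (le_trans (ler_norm _)) // -sqrtr_sqr ler_wsqrtr // lerDl sqr_ge0.
Qed.

Lemma sqnD_le m (x y : 'cV[C]_m) : sqn (x + y) <= 2 * (sqn x + sqn y).
Proof.
have := sqn_ge0 (x - y); rewrite !sqnD sqnN dotNr ReN; lra.
Qed.

End Vectors.

(** * Eigenbases of Hermitian matrices *)

Section Spectrum.
Variable R : realType.
Local Notation C := R[i].

(** Orthonormality, completeness and diagonality are phrased on a family of
columns, which can be permuted freely when eigenvalues are sorted. *)
Definition eigenbasis m (H : 'M[C]_m) (u : 'I_m -> 'cV[C]_m) (D : 'I_m -> R) :=
  [/\ forall i j, dot (cmx (u i)) (u j) = (i == j)%:R,
      forall y, y = \sum_i dot (cmx (u i)) y *: u i
    & forall i, H *m u i = (D i)%:C *: u i].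

Lemma char_poly_eigenbasis m (H : 'M[C]_m) u D : eigenbasis H u D ->
  char_poly H = \prod_i ('X - ((D i)%:C)%:P).
Proof.
move=> [ort cpl eig].
pose U : 'M[C]_m := \matrix_(i, j) u j i 0.
have UU : (cmx U)^T *m U = 1%:M.
  apply/matrixP => i j; rewrite !mxE -ort dotE.
  by apply: eq_bigr => k _; rewrite !mxE.
pose E := diag_mx (\row_i (D i)%:C).
have HU : H *m U = U *m E.
  apply/matrixP => i j; have /matrixP/(_ i 0) := eig j.
  rewrite mul_mx_diag !mxE mulrC => <-.
  by apply: eq_bigr => k _; rewrite !mxE.
have -> : char_poly H = char_poly E.
  have UU' := mulmx1C UU.
  have HE : H = U *m E *m (cmx U)^T by rewrite -HU -mulmxA UU' mulmx1.
  pose V := map_mx polyC U; pose W := map_mx polyC (cmx U)^T.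
  have VW : V *m W = 1%:M by rewrite -map_mxM UU' map_mx1.
  rewrite /char_poly.
  have -> : char_poly_mx H = V *m char_poly_mx E *m W.
    rewrite /char_poly_mx mulmxBr mulmxBl -!map_mxM -HE; congr (_ - _).
    by rewrite -scalemx1 -scalemxAr mulmx1 -scalemxAl VW.
  rewrite !det_mulmx mulrAC -det_mulmx VW det1 mul1r; done.
rewrite char_poly_trig ?diag_mx_is_trig //.
by apply: eq_bigr => i _; rewrite !mxE eqxx.
Qed.

(** The spectral theorem for rows, read on the conjugated rows as columns. *)
Lemma exists_eigenbasis m (H : 'M[C]_m) : Defs.adjmx H = H ->
  exists u D, eigenbasis H u D.
Proof.
move=> hH.
have hermH : H \is hermsymmx.
  apply/is_hermitianmxP; rewrite expr0 scale1r -[in LHS]hH.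
  by apply/matrixP => i j; rewrite !mxE.
have /orthomx_spectralP := hermitian_normalmx hermH.
have /unitarymxP PP := spectral_unitarymx H.
have Pu := spectral_unitarymx H.
have /mxOverP dreal := hermitian_spectral_diag_real hermH.
set P := spectralmx H in PP Pu *; set d := spectral_diag H in dreal * => HE.
have PP' := mulmx1C PP.
exists (fun i => col i (map_mx Num.conj P^T)), (fun i => complex.Re (d 0 i)); split.
- move=> i j; have /matrixP/(_ i j) := PP; rewrite !mxE dotE => <-.
  apply: eq_bigr => k _; rewrite !mxE; congr (_ * _).
  by rewrite -[RHS]conjcK.
- move=> y; rewrite -[LHS]mul1mx -PP' -mulmxA.
  apply/matrixP => i j; rewrite (ord1 j) !mxE summxE; apply: eq_bigr => k _.
  rewrite !mxE mulrC dotE; congr (_ * _); apply: eq_bigr => l _; rewrite !mxE.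
  by congr (_ * _); rewrite -[LHS]conjcK.
- move=> i.
  have -> : (complex.Re (d 0 i))%:C = d 0 i by apply: RRe_real; apply: dreal.
  rewrite {1}HE invmx_unitary // colE -!mulmxA.
  rewrite [P *m (_ *m _)]mulmxA PP mul1mx.
  have -> : diag_mx d *m delta_mx i 0 = d 0 i *: delta_mx i 0 :> 'cV_m.
    apply/matrixP => a b; rewrite mul_diag_mx !mxE.
    by case: eqP => [->|] //=; rewrite ?mulr0.
  by rewrite scalemxAr.
Qed.

(** The sorted list of eigenvalues that defines [lambda2] and the diagonal of the
spectral theorem are permutations of each other, because both list the roots of
the characteristic polynomial; permuting the basis accordingly makes [lambda2]
its entry of index [1]. *)
Lemma spectral_sorted m (H : 'M[C]_m) : Defs.adjmx H = H ->
  exists u D, [/\ eigenbasis H u D, (forall i j : 'I_m, (i <= j)%N -> D j <= D i)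
    & forall i : 'I_m, i = 1%N :> nat -> D i = lambda2 H].
Proof.
move=> /exists_eigenbasis [u [D eb]].
have pe : perm_eq (eigenvalues H) [seq (D i)%:C | i <- enum 'I_m].
  apply: prod_XsubC_eq; rewrite big_map big_enum /=.
  rewrite -(char_poly_eigenbasis eb).
  rewrite /eigenvalues; case: closed_field_poly_normal => /= s ->.
  by rewrite (monicP (char_poly_monic H)) scale1r.
set s := sort (fun x y : R => y <= x) [seq complex.Re z | z <- eigenvalues H].
have ps : perm_eq s [tuple D i | i < m].
  rewrite perm_sort (permPl (perm_map (@complex.Re R) pe)) -map_comp.
  by rewrite /= perm_refl.
have ss : sorted (fun x y : R => y <= x) s by apply: sort_sorted => x y; apply: le_total.
have [p sE] := tuple_permP ps.
have nthE (i : 'I_m) : nth 0 s i = D (p i).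
  by rewrite sE -tnth_nth !tnth_mktuple.
have szs : size s = m by rewrite (perm_size ps) size_tuple.
exists (fun i => u (p i)), (fun i => D (p i)); case: eb => ort cpl eig; split.
- split=> [i j|y|i]; last exact: eig.
    by rewrite ort (inj_eq perm_inj).
  by rewrite {1}(cpl y) (reindex_inj (@perm_inj _ p)).
- move=> i j ij; rewrite -!nthE.
  apply: (sorted_leq_nth _ _ _ ss) => //; rewrite ?inE ?szs ?ltn_ord //.
    by move=> y x z /= h1 h2; apply: le_trans h2 h1.
- by move=> i i1; rewrite -nthE i1.
Qed.

Lemma sqn_eigenbasis m (H : 'M[C]_m) u D y : eigenbasis H u D ->
  sqn y = \sum_i nsq (dot (cmx (u i)) y).
Proof.
move=> [ort cpl eig]; rewrite /sqn {2}(cpl y) dot_sumr Re_sum.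
apply: eq_bigr => i _; rewrite dotZr /nsq mulrC; congr (complex.Re (_ * _)).
by rewrite conj_dot cmxK dotC.
Qed.

Lemma qf_eigenbasis m (H : 'M[C]_m) u D y : eigenbasis H u D ->
  qf H y = \sum_i D i * nsq (dot (cmx (u i)) y).
Proof.
move=> [ort cpl eig]; rewrite /qf {2}(cpl y) mulmx_sumr dot_sumr Re_sum.
apply: eq_bigr => i _; rewrite -scalemxAr eig !dotZr mulrCA ReZ.
rewrite /nsq [_^* * _]mulrC; congr (_ * complex.Re (_ * _)).
by rewrite conj_dot cmxK dotC.
Qed.

End Spectrum.

(** * Variational estimates of the second largest eigenvalue *)

Section SecondEigenvalue.
Variable R : realType.
Local Notation C := R[i].

Lemma Re_sqr_le (c : C) : complex.Re c ^+ 2 <= nsq c.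
Proof. by case: c => a b; rewrite /nsq /=; nra. Qed.

(** Expand [t |a - b / t|^2 >= 0]. *)
Lemma Re_young (a b : C) (t : R) : 0 < t ->
  2 * complex.Re (a^* * b) <= t * nsq a + nsq b / t.
Proof.
move=> t0; rewrite -subr_ge0.
have -> : t * nsq a + nsq b / t - 2 * complex.Re (a^* * b) =
   t * nsq (a - (t^-1)%:C * b).
  case: a b => [a1 a2] [b1 b2]; rewrite /nsq /=; field; exact: lt0r_neq0.
by rewrite mulr_ge0 ?nsq_ge0 // ltW.
Qed.

Lemma sqn_mulmx_bounded m n (A : 'M[C]_(m, n)) :
  exists2 K : R, 0 <= K & forall y, sqn (A *m y) <= K * sqn y.
Proof.
exists (\sum_i sqn (cmx (row i A)^T)).
  by apply: sumr_ge0 => i _; apply: sqn_ge0.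
move=> y; rewrite [leLHS]sqn_sum mulr_suml; apply: ler_sum => i _.
apply: le_trans (cauchy_schwarz _ _); rewrite cmxK dotE mxE le_eqVlt; apply/orP; left.
by apply/eqP; congr nsq; apply: eq_bigr => j _; rewrite !mxE.
Qed.

Lemma qf_bounded n (A : 'M[C]_n) :
  exists2 K : R, 0 <= K & forall y, qf A y <= K * sqn y.
Proof.
have [K K0 hK] := sqn_mulmx_bounded A; exists (1 + K); first lra.
move=> y; have := @Re_young 1 (dot (cmx y) (A *m y)).
have := @cauchy_schwarz _ _ y (A *m y); have := hK y; rewrite /qf.
set c := dot _ _ => h1 h2 _.
have sy := sqn_ge0 y.
have h3 := le_trans (Re_sqr_le c) h2.
have h4 : complex.Re c ^+ 2 <= K * sqn y ^+ 2 by nra.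
rewrite leNgt; apply/negP => h5.
have : ((1 + K) * sqn y) ^+ 2 < complex.Re c ^+ 2.
  by rewrite ltr_sqr ?nnegrE //; [apply: mulr_ge0; lra | apply: le_trans (ltW h5); apply: mulr_ge0; lra].
suff : K * sqn y ^+ 2 <= ((1 + K) * sqn y) ^+ 2 by lra.
by rewrite exprMn ler_wpM2r ?sqr_ge0 //; nra.
Qed.

Lemma orthogonal_in_plane m (W : 'M[C]_(m, 2)) (e : 'cV[C]_m) :
  exists2 c : 'cV[C]_2, c != 0 & dot (cmx e) (W *m c) = 0.
Proof.
suff [c c0 h] : exists2 c : 'cV[C]_2, c != 0 & ((cmx e)^T *m W *m c) 0 0 = 0.
  by exists c => //; rewrite /dot mulmxA.
move: ((cmx e)^T *m W) => r.
have E c : (r *m c) 0 0 = r 0 0 * c 0 0 + r 0 1 * c 1 0.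
  by rewrite mxE big_ord_recl big_ord1 /=; congr (_ + r 0 _ * c _ 0); apply/val_inj.
case: (eqVneq (r 0 1) 0) => r1.
  exists (\col_i (i == 1)%:R); last by rewrite E r1 !mxE eqxx mulr0 mul0r addr0.
  by apply/eqP => /matrixP/(_ 1 0); rewrite !mxE eqxx => /eqP; rewrite oner_eq0.
exists (\col_i (if i == 0 then r 0 1 else - r 0 0)).
  by apply/eqP => /matrixP/(_ 0 0); rewrite !mxE eqxx => /eqP; rewrite (negbTE r1).
by rewrite E !mxE eqxx /=; ring.
Qed.

(** Half of the min-max principle: a plane always meets the orthogonal complement
of the top eigenvector, and there the form is at most [lambda2]. *)
Lemma lambda2_ge m (H : 'M[C]_m) (W : 'M[C]_(m, 2)) (s : R) : (1 < m)%N ->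
  Defs.adjmx H = H -> (forall c : 'cV[C]_2, W *m c = 0 -> c = 0) ->
  (forall c : 'cV[C]_2, s * sqn (W *m c) <= qf H (W *m c)) -> s <= lambda2 H.
Proof.
move=> m1 hH inj hs; have [u [D [eb srt l2]]] := spectral_sorted hH.
pose i0 := Ordinal (ltnW m1); pose i1 := Ordinal m1.
have [c c0 ort] := orthogonal_in_plane W (u i0).
have y0 : 0 < sqn (W *m c).
  by rewrite sqn_gt0; apply/eqP => /inj/eqP; rewrite (negbTE c0).
rewrite -(ler_pM2r y0); apply: (le_trans (hs c)).
rewrite (qf_eigenbasis _ eb) (sqn_eigenbasis _ eb) mulr_sumr.
apply: ler_sum => i _; have [->|ne] := eqVneq i i0.
  by rewrite ort nsq0 !mulr0.
rewrite ler_wpM2r ?nsq_ge0 // -(l2 i1 erefl); apply: srt.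
by rewrite lt0n; apply: contra ne => /eqP e; apply/eqP/val_inj.
Qed.

Lemma lambda2_ge_plane m (H : 'M[C]_m) (w1 w2 : 'cV[C]_m) (s : R) : (1 < m)%N ->
  Defs.adjmx H = H ->
  (forall a b, a *: w1 + b *: w2 = 0 -> a = 0 /\ b = 0) ->
  (forall a b, s * sqn (a *: w1 + b *: w2) <= qf H (a *: w1 + b *: w2)) ->
  s <= lambda2 H.
Proof.
move=> m1 hH inj hs.
pose W : 'M[C]_(m, 2) := \matrix_(i, j) (if j == 0 then w1 i 0 else w2 i 0).
have WE c : W *m c = c 0 0 *: w1 + c 1 0 *: w2.
  apply/matrixP => i j; rewrite (ord1 j) mxE big_ord_recl big_ord1 !mxE /=.
  rewrite mulrC; congr (_ + _); rewrite mulrC; congr (c _ _ * _); exact/val_inj.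
apply: (lambda2_ge (W := W)) => // c; rewrite WE // => /inj [c0 c1].
apply/matrixP => i j; rewrite (ord1 j) mxE; case: i => [[|[|?]] ?] //.
  by rewrite -[RHS]c0; congr (c _ _); apply/val_inj.
by rewrite -[RHS]c1; congr (c _ _); apply/val_inj.
Qed.

(** The other half: the span of the first two eigenvectors. *)
Lemma lambda2_attained m (H : 'M[C]_m) : (1 < m)%N -> Defs.adjmx H = H ->
  exists2 W : 'M[C]_(m, 2), (forall c : 'cV[C]_2, W *m c = 0 -> c = 0) &
    forall c : 'cV[C]_2, lambda2 H * sqn (W *m c) <= qf H (W *m c).
Proof.
move=> m1 hH; have [u [D [eb srt l2]]] := spectral_sorted hH.
pose i0 := Ordinal (ltnW m1); pose i1 := Ordinal m1.
pose v (j : 'I_2) := if j == 0 then i0 else i1.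
pose W : 'M[C]_(m, 2) := \matrix_(i, j) u (v j) i 0.
have [ort cpl eig] := eb.
have cE i c : dot (cmx (u i)) (W *m c) = \sum_j c j 0 * (i == v j)%:R.
  have -> : W *m c = \sum_j c j 0 *: u (v j).
    apply/matrixP => a b; rewrite (ord1 b) !mxE summxE; apply: eq_bigr => j _.
    by rewrite !mxE mulrC.
  by rewrite dot_sumr; apply: eq_bigr => j _; rewrite dotZr ort.
have vinj : injective v.
  by move=> [[|[|?]] ?] [[|[|?]] ?] // *; apply/val_inj.
exists W => c.
  move=> h; apply/matrixP => j k; rewrite (ord1 k) mxE.
  have := cE (v j) c; rewrite h dot0r (bigD1 j) //= eqxx mulr1 big1 ?addr0 //.
  by move=> k' /negbTE ne; rewrite (inj_eq vinj) eq_sym ne mulr0.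
rewrite (qf_eigenbasis _ eb) (sqn_eigenbasis _ eb) mulr_sumr.
apply: ler_sum => i _; case: (leqP i 1) => hi.
  by rewrite ler_wpM2r ?nsq_ge0 // -(l2 i1 erefl) srt.
rewrite cE big1 => [|j _]; first by rewrite nsq0 !mulr0.
rewrite (_ : (i == v j) = false) ?mulr0 //.
by apply/eqP => h; move: hi; rewrite h /v; case: ifP.
Qed.

(** Serves both for perturbations of a matrix ([T] the identity) and for unitary
changes of basis ([eps = 0]). *)
Lemma lambda2_le m (H H' T : 'M[C]_m) (eps : R) : (1 < m)%N ->
  Defs.adjmx H = H -> Defs.adjmx H' = H' -> (forall y, sqn (T *m y) = sqn y) ->
  (forall y, qf H' y <= qf H (T *m y) + eps * sqn y) ->
  lambda2 H' <= lambda2 H + eps.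
Proof.
move=> m1 hH hH' iso le; rewrite -lerBlDr.
have [W inj hW] := lambda2_attained m1 hH'.
apply: (lambda2_ge (W := T *m W) m1 hH) => c.
  rewrite -mulmxA => /eqP; rewrite -sqn_eq0 iso sqn_eq0 => /eqP; exact: inj.
rewrite -mulmxA iso; have := le (W *m c); have := hW c; lra.
Qed.

(** The plane of the first two eigenvectors contains a nonzero vector orthogonal to
[e]. *)
Lemma lambda2_lt m (H : 'M[C]_m) (e : 'cV[C]_m) (s : R) : (1 < m)%N ->
  Defs.adjmx H = H ->
  (forall y, y != 0 -> dot (cmx e) y = 0 -> qf H y < s * sqn y) -> lambda2 H < s.
Proof.
move=> m1 hH h; have [W inj hW] := lambda2_attained m1 hH.
have [c c0 ort] := orthogonal_in_plane W e.
have y0 : W *m c != 0 by apply/eqP => /inj/eqP; rewrite (negbTE c0).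
rewrite -(ltr_pM2r (_ : 0 < sqn (W *m c))) ?sqn_gt0 //.
by apply: le_lt_trans (hW c) (h _ _ _).
Qed.

Lemma dot_adj m n (A : 'M[C]_(m, n)) x y :
  dot (cmx x) (A *m y) = dot (cmx (Defs.adjmx A *m x)) y.
Proof. by rewrite dot_mulmx cmxM /Defs.adjmx cmx_tr cmxK. Qed.

Lemma qf_add m (T : 'M[C]_m) a x z : Defs.adjmx T = T ->
  qf T (a *: x + z) = nsq a * qf T x + qf T z
     + 2 * complex.Re (a^* * dot (cmx (T *m x)) z).
Proof.
move=> hT; rewrite -qfZ {1}/qf mulmxDr cmxD !(dotDl, dotDr) !ReD.
have -> : dot (cmx z) (T *m (a *: x)) = (dot (cmx (a *: x)) (T *m z))^*.
  by rewrite dot_adj hT conj_dot cmxK dotC.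
rewrite ReJ -/(qf T z) -/(qf T (a *: x)).
by rewrite cmxZ dotZl dot_adj hT; ring.
Qed.

Lemma uniform_gap (I : finType) (P : pred I) (f : I -> R) :
  (forall i, P i -> 0 < f i) -> exists2 d, 0 < d & forall i, P i -> d <= f i.
Proof.
move=> h; exists (\big[Num.min/1]_(i | P i) f i).
  by apply: lt_bigmin => //; rewrite ltr01.
by move=> i Pi; apply: bigmin_le_cond.
Qed.

(** First-order perturbation of a simple second eigenvalue, in the only form needed
below: if the derivative [qf T w] along [T] is negative, a small step lowers
[lambda2]. By [lambda2_lt] it suffices to bound the form of [H + eps T] on the
orthogonal complement of the top eigenvector. There [y = a w + z] with [z]
orthogonal to [w]; the gap [dl] below the simple eigenvalue controls [|z|^2], the
negative derivative controls [|a|^2], and the cross term is split between both by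
Young's inequality. *)
Lemma simple_lambda2 m (H : 'M[C]_m) : (1 < m)%N -> Defs.adjmx H = H ->
  simple_eigenvalue H (lambda2 H)%:C ->
  exists w, [/\ w != 0, H *m w = (lambda2 H)%:C *: w,
     forall w', H *m w' = (lambda2 H)%:C *: w' -> exists c, w' = c *: w
   & forall T, Defs.adjmx T = T -> qf T w < 0 ->
       exists2 eps : R, 0 < eps & lambda2 (H + eps%:C *: T) < lambda2 H].
Proof.
move=> m1 hH simple; have [u [D [eb srt l2]]] := spectral_sorted hH.
pose i0 := Ordinal (ltnW m1); pose i1 := Ordinal m1.
set l := lambda2 H in simple *.
have [ort cpl eig] := eb.
have Di1 : D i1 = l by apply: l2.
have Dne i : i != i1 -> D i != l.
  move=> ne; apply/eqP => e; move: simple; rewrite /simple_eigenvalue.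
  rewrite (char_poly_eigenbasis eb).
  have -> : \prod_i ('X - ((D i)%:C)%:P) =
      \prod_(a <- [seq (D i)%:C | i <- enum 'I_m]) ('X - a%:P).
    by rewrite big_map big_enum.
  rewrite mu_prod_XsubC count_map => h.
  have : (size [:: i; i1] <= count (preim (fun i => (D i)%:C) (pred1 l%:C)) (enum 'I_m))%N.
    rewrite -size_filter; apply: uniq_leq_size; first by rewrite /= inE ne.
    move=> x; rewrite !inE mem_filter mem_enum andbT /= => /orP[]/eqP->.
      by rewrite e.
    by rewrite Di1.
  by rewrite h.
exists (u i1).
have sw : sqn (u i1) = 1 by rewrite /sqn ort eqxx.
have w0 : u i1 != 0 by rewrite -sqn_gt0 sw ltr01.
split=> //; first by rewrite eig Di1.
- move=> w' hw'; exists (dot (cmx (u i1)) w').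
  rewrite {1}(cpl w') (bigD1 i1) //= big1 ?addr0 // => i ne.
  suff -> : dot (cmx (u i)) w' = 0 by rewrite scale0r.
  have : (D i)%:C * dot (cmx (u i)) w' = l%:C * dot (cmx (u i)) w'.
    by rewrite -[RHS]dotZr -hw' dot_adj hH eig cmxZ conjR dotZl.
  move/eqP; rewrite -subr_eq0 -mulrBl mulf_eq0 => /orP[|/eqP//].
  by rewrite subr_eq0 => /eqP/complexI/eqP; rewrite (negbTE (Dne i ne)).
- move=> T hT neg.
  have [dl dl0 hdl] : exists2 d, 0 < d &
      forall i, (i != i0) && (i != i1) -> d <= l - D i.
    apply: uniform_gap => i /andP[n0 n1]; rewrite subr_gt0 lt_neqAle Dne //=.
    rewrite -Di1; apply: srt; rewrite /= lt0n; apply: contra n0 => /eqP h.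
    by apply/eqP/val_inj.
  have [K K0 hK] := qf_bounded T.
  set g := - qf T (u i1); have g0 : 0 < g by rewrite /g; lra.
  pose rho := sqn (T *m u i1); have rho0 : 0 <= rho by apply: sqn_ge0.
  (* [k] collects what the cross term and [qf T z] contribute to [|z|^2] once half of
     the negative derivative [g] has absorbed the rest. *)
  pose k := rho / (g / 2) + K.
  have k0 : 0 <= k by rewrite addr_ge0 ?divr_ge0 //; lra.
  exists (dl / (k + 1)); first by apply: divr_gt0; lra.
  set eps := dl / _; have eps0 : 0 < eps by apply: divr_gt0; lra.
  have epsk : eps * k < dl.
    have -> : dl = eps * (k + 1) by rewrite /eps mulfVK //; apply: lt0r_neq0; lra.
    nra.
  have hHT : Defs.adjmx (H + eps%:C *: T) = H + eps%:C *: T.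
    rewrite -[in RHS]hH -[in RHS]hT.
    by apply/matrixP => i j; rewrite !mxE conjD conjM conjR.
  apply: (lambda2_lt (e := u i0)) => // y y0 ort0.
  pose a := dot (cmx (u i1)) y; pose z := y - a *: u i1.
  have yE : y = a *: u i1 + z by rewrite addrC subrK.
  have wz : dot (cmx (u i1)) z = 0.
    by rewrite dotDr dotNr dotZr ort eqxx mulr1 subrr.
  have sy : sqn y = nsq a + sqn z.
    by rewrite {1}yE sqn_orth ?sqnZ ?sw ?mulr1 // cmxZ dotZl wz mulr0.
  have coef i : i != i1 -> dot (cmx (u i)) z = dot (cmx (u i)) y.
    by move=> /negbTE ne; rewrite dotDr dotNr dotZr ort ne mulr0 subr0.
  have qz : qf H y <= l * nsq a + (l - dl) * sqn z.
    rewrite (qf_eigenbasis _ eb) (bigD1 i1) //= Di1 lerD2l.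
    rewrite (sqn_eigenbasis _ eb) mulr_sumr [leRHS](bigD1 i1) //= wz.
    rewrite nsq0 mulr0 add0r; apply: ler_sum => i ne.
    rewrite coef //; have [->|n0] := eqVneq i i0.
      by rewrite ort0 nsq0 !mulr0.
    by rewrite ler_wpM2r ?nsq_ge0 //; have := hdl i; rewrite n0 ne; lra.
  have qt : qf T y <= - (g / 2) * nsq a + k * sqn z.
    rewrite {1}yE qf_add //.
    have g2 : 0 < g / 2 by lra.
    have := @Re_young a (dot (cmx (T *m u i1)) z) _ g2.
    have := hK z.
    have : nsq (dot (cmx (T *m u i1)) z) / (g / 2) <= rho / (g / 2) * sqn z.
      by rewrite mulrAC ler_wpM2r ?invr_ge0 ?(ltW g2) // cauchy_schwarz.
    have -> : qf T (u i1) = - g by rewrite /g opprK.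
    rewrite /k; nra.
  rewrite qfD qfZl sy.
  have h : 0 < nsq a \/ 0 < sqn z.
    have : 0 < nsq a + sqn z by rewrite -sy sqn_gt0.
    have := nsq_ge0 a; rewrite le_eqVlt => /orP[/eqP <-|]; last by left.
    by rewrite add0r; right.
  have h1 := nsq_ge0 a; have h2 := sqn_ge0 z.
  have h3 : eps * qf T y <= eps * (- (g / 2) * nsq a + k * sqn z).
    by rewrite ler_wpM2l // ltW.
  have h4 : 0 < eps * g by apply: mulr_gt0.
  have h5 : (eps * k - dl) * sqn z <= 0 by rewrite mulr_le0_ge0 //; lra.
  case: h => h; nra.
Qed.

End SecondEigenvalue.

(** * Symmetric and skew-symmetric matrices of least norm with a prescribed value *)

Section MinimalMappings.
Variable R : realType.
Local Notation C := R[i].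

Section SpectralNorm.
Variables (n : nat) (n_gt0 : (0 < n)%N).
Implicit Types A : 'M[C]_n.

Lemma unit_vector_exists : exists x : 'cV[C]_n, sqn x = 1.
Proof.
exists (delta_mx (Ordinal n_gt0) 0); rewrite sqn_sum (bigD1 (Ordinal n_gt0)) //=.
rewrite mxE !eqxx big1 ?addr0 => [|i /negbTE ne]; last by rewrite mxE ne nsq0.
by rewrite /nsq conjc1 mul1r.
Qed.

Lemma vnorm_le (x y : 'cV[C]_n) (s : R) :
  0 <= s -> sqn x <= s ^+ 2 * sqn y -> vnorm x <= s * vnorm y.
Proof.
move=> s0 h; rewrite -ler_sqr ?nnegrE ?mulr_ge0 ?vnormE ?sqrtr_ge0 //.
by rewrite exprMn !sqr_sqrtr ?sqn_ge0.
Qed.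

Lemma spectral_norm_le A (s : R) : 0 <= s ->
  (forall y, sqn (A *m y) <= s ^+ 2 * sqn y) -> spectral_norm A <= s.
Proof.
move=> s0 h; have [x x1] := unit_vector_exists.
apply: ge_sup; first by exists (vnorm (A *m x)), x => //=; rewrite vnormE x1 sqrtr1.
by move=> _ [y /= y1 <-]; rewrite -[s]mulr1 -y1; apply: vnorm_le.
Qed.

Lemma vnorm_le_spectral_norm A x : vnorm x = 1 -> vnorm (A *m x) <= spectral_norm A.
Proof.
move=> x1; have [K K0 hK] := sqn_mulmx_bounded A.
apply: ub_le_sup; last by exists x.
exists (1 + K) => _ [y /= y1 <-]; rewrite -[1 + K]mulr1 -y1.
apply: vnorm_le; first lra.
by apply: le_trans (hK y) _; rewrite ler_wpM2r ?sqn_ge0 //; nra.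
Qed.

Lemma spectral_norm_ge0 A : 0 <= spectral_norm A.
Proof.
have [x x1] := unit_vector_exists.
by apply: le_trans (vnorm_le_spectral_norm A (x := x) _);
  rewrite vnormE ?sqrtr_ge0 // x1 sqrtr1.
Qed.

Lemma sqn_mulmx_le A x : sqn (A *m x) <= spectral_norm A ^+ 2 * sqn x.
Proof.
have [->|x0] := eqVneq x 0; first by rewrite mulmx0 sqn0 mulr0.
have v0 : 0 < sqn x by rewrite sqn_gt0.
have vx : 0 < vnorm x by rewrite vnormE sqrtr_gt0.
have c0 : vnorm x != 0 by apply: lt0r_neq0.
pose x1 := ((vnorm x)^-1)%:C *: x.
have sx1 : sqn x1 = 1 by rewrite sqnZ nsq_real -vnorm_sqr; field.
have := @vnorm_le_spectral_norm A x1 _; rewrite {1}vnormE sx1 sqrtr1 => /(_ erefl).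
rewrite -ler_sqr ?nnegrE ?spectral_norm_ge0 ?vnormE ?sqrtr_ge0 // -!vnormE.
by rewrite vnorm_sqr -scalemxAr sqnZ nsq_real exprVn vnorm_sqr mulrC ler_pdivrMr.
Qed.

End SpectralNorm.

(** Both minimal mappings below have the form [r p^* + s q^*] with orthogonal [p, q]
and orthogonal [r, s]; Bessel's inequality bounds their norm. *)
Lemma sqn_rank2_le n (r p s q a : 'cV[C]_n) (mu : R) :
  dot (cmx p) q = 0 -> dot (cmx r) s = 0 -> 0 <= mu ->
  sqn p * sqn r <= mu -> sqn q * sqn s <= mu ->
  sqn ((r *m (cmx p)^T + s *m (cmx q)^T) *m a) <= mu * sqn a.
Proof.
move=> pq rs mu0 h1 h2.
rewrite mulmxDl !rank1_mulmx sqn_orth ?cmxZ ?dotZl ?dotZr ?rs ?mulr0 // !sqnZ.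
apply: le_trans (ler_wpM2l mu0 (bessel a pq)); rewrite mulrDr.
have le1 (x y : 'cV[C]_n) : sqn x * sqn y <= mu ->
    nsq (dot (cmx x) a) * sqn y <= mu * (nsq (dot (cmx x) a) / sqn x).
  have [->|x0] := eqVneq x 0; first by rewrite cmx0 dot0l nsq0 !mul0r mulr0.
  move=> h; have sx : 0 < sqn x by rewrite sqn_gt0.
  rewrite mulrCA ler_wpM2l ?nsq_ge0 //.
  by rewrite ler_pdivlMr // mulrC.
by apply: lerD; apply: le1.
Qed.

(** The matrix is [(v x^* - conj(x) v^T) / |x|^2]; the hypothesis [x^T v = 0] makes
[x] orthogonal to [conj v], and [v] to [conj x]. *)
Lemma skew_mapping n (x v : 'cV[C]_n) : x != 0 -> dot x v = 0 ->
  exists S : 'M[C]_n, [/\ S^T = - S, S *m x = v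
    & forall a, sqn (S *m a) <= sqn v / sqn x * sqn a].
Proof.
move=> x0 xv; have sx : 0 < sqn x by rewrite sqn_gt0.
have sxn := lt0r_neq0 sx.
exists ((((sqn x)^-1)%:C *: v) *m (cmx x)^T
       + (- ((sqn x)^-1)%:C *: cmx x) *m (cmx (cmx v))^T); split.
- rewrite cmxK; apply/matrixP => i j; rewrite !(mxE, big_ord1); ring.
- rewrite mulmxDl !rank1_mulmx cmxK (dotC v) xv scale0r addr0 -sqnE scalerA.
  by rewrite -rmorphM mulfV // scale1r.
- move=> a; apply: sqn_rank2_le.
  + by rewrite -conj_dot xv conjc0.
  + by rewrite cmxZ dotZl dotZr -conj_dot dotC xv conjc0 !mulr0.
  + by rewrite divr_ge0 ?sqn_ge0.
  + by rewrite sqnZ nsq_real le_eqVlt; apply/orP; left; apply/eqP; field.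
  + rewrite !sqnZ nsqN nsq_real !sqnJ.
    by rewrite le_eqVlt; apply/orP; left; apply/eqP; field.
Qed.

Lemma phase_exists (c : C) :
  exists2 t : C, nsq t = 1 & t * c = (Normc.normc c)%:C.
Proof.
have [->|c0] := eqVneq c 0.
  by exists 1; [rewrite /nsq conjc1 mul1r | rewrite mulr0 Normc.normc0].
have n0 : Normc.normc c != 0 by apply: contra c0 => /eqP/Normc.eq0_normc ->.
exists (((Normc.normc c)^-1)%:C * c^*).
  by rewrite nsqM nsqJ nsq_real nsqEn exprVn mulVf // expf_neq0.
by rewrite -mulrA -nsqE -rmorphM nsqEn expr2 mulKf.
Qed.

Lemma halfC : (2^-1 : R)%:C = 2^-1 :> C.
Proof. by rewrite -invrC; congr (_^-1); apply: (rmorph_nat (real_complex R)). Qed.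

(** Let [y] be [conj v], rescaled to the length of [x] and multiplied by a phase that
makes [x^* y] real. Then [p = x + y] and [q = x - y] are orthogonal, and up to a
scalar the matrix is [conj(p) p^* / |p|^2 - conj(q) q^* / |q|^2], visibly symmetric.
As [x^* y] is real, [p^* x = |p|^2 / 2] and [q^* x = |q|^2 / 2]; so [x] goes to
[conj(p - q) / 2 = conj y], a multiple of [v]. The argument survives [p = 0] or
[q = 0] because the inverse of [0] is [0]. *)
Lemma sym_mapping n (x v : 'cV[C]_n) : x != 0 ->
  exists S : 'M[C]_n, [/\ S^T = S, S *m x = v
    & forall a, sqn (S *m a) <= sqn v / sqn x * sqn a].
Proof.
move=> x0; have sx : 0 < sqn x by rewrite sqn_gt0.
have sxn := lt0r_neq0 sx.
have [v0|v0] := eqVneq v 0.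
  exists 0; split; rewrite ?trmx0 ?mul0mx ?v0 // => a.
  by rewrite mul0mx sqn0 mul0r mul0r.
have [t t1 hrho] := phase_exists (dot x v); set rho := Normc.normc _ in hrho.
have sv : 0 < sqn v by rewrite sqn_gt0.
pose k := Num.sqrt (sqn x / sqn v).
have kk : k ^+ 2 = sqn x / sqn v by rewrite sqr_sqrtr // divr_ge0 ?sqn_ge0.
pose y := cmx ((t * k%:C) *: v).
have sy : sqn y = sqn x.
  by rewrite sqnJ sqnZ nsqM t1 nsq_real kk; field; apply: lt0r_neq0.
have xy : dot (cmx x) y = (k * rho)%:C.
  rewrite -conj_dot dotZr mulrAC hrho -rmorphM conjR mulrC; done.
have yx : dot (cmx y) x = (k * rho)%:C.
  by rewrite -[LHS]conjcK conj_dot cmxK dotC xy conjR.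
pose p := x + y; pose q := x - y.
have pq : dot (cmx p) q = 0.
  rewrite cmxD !(dotDl, dotDr, dotNr) xy yx -!sqnE sy; ring.
have spE : sqn p = 2 * (sqn x + k * rho).
  by rewrite sqnD xy sy /=; ring.
have sqE : sqn q = 2 * (sqn x - k * rho).
  by rewrite sqnD sqnN dotNr xy sy /=; ring.
pose c : C := (t * k%:C)^-1.
have tk0 : t * k%:C != 0.
  rewrite -nsq_eq0 nsqM t1 nsq_real kk mul1r; apply: lt0r_neq0.
  by rewrite divr_gt0.
have cv : c *: cmx y = v by rewrite cmxK scalerA mulVf // scale1r.
have nc : nsq c = sqn v / sqn x.
  have : sqn (c *: cmx y) = sqn v by rewrite cv.
  by rewrite sqnZ sqnJ sy => <-; rewrite mulfK.
pose ip := ((sqn p)^-1)%:C; pose iq := ((sqn q)^-1)%:C.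
exists (((c * ip) *: cmx p) *m (cmx p)^T + ((- (c * iq)) *: cmx q) *m (cmx q)^T).
split.
- by apply/matrixP => i j; rewrite !(mxE, big_ord1); ring.
- rewrite mulmxDl !rank1_mulmx.
  have px : dot (cmx p) x = (sqn p / 2)%:C.
    by rewrite cmxD dotDl yx -sqnE -rmorphD spE; congr (_%:C); field.
  have qx : dot (cmx q) x = (sqn q / 2)%:C.
    rewrite cmxD cmxN dotDl dotNl yx -sqnE -rmorphN -rmorphD sqE; congr (_%:C).
    by field.
  have hp : dot (cmx p) x *: (c * ip *: cmx p) = (c / 2) *: cmx p.
    have [->|nz] := eqVneq p 0; first by rewrite cmx0 !scaler0.
    have np : sqn p != 0 by rewrite sqn_eq0.
    rewrite scalerA px mulrCA -rmorphM mulrAC mulfV // mul1r; congr (_ * _ *: _).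
    exact: halfC.
  have hq : dot (cmx q) x *: (- (c * iq) *: cmx q) = - ((c / 2) *: cmx q).
    have [->|nz] := eqVneq q 0; first by rewrite cmx0 !scaler0 oppr0.
    have np : sqn q != 0 by rewrite sqn_eq0.
    rewrite scaleNr scalerN; congr (- _).
    rewrite scalerA qx mulrCA -rmorphM mulrAC mulfV // mul1r; congr (_ * _ *: _).
    exact: halfC.
  rewrite hp hq -scalerBr cmxD cmxD cmxN opprD opprK addrACA subrr add0r.
  have -> : cmx y + cmx y = (2 : C) *: cmx y by rewrite scaler_nat mulr2n.
  by rewrite scalerA mulfVK ?cv // pnatr_eq0.
- move=> a; have pq' : dot (cmx (cmx p)) (cmx q) = 0 by rewrite -conj_dot pq conjc0.
  have key z : sqn z * sqn ((c * ((sqn z)^-1)%:C) *: cmx z) <= sqn v / sqn x.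
    rewrite sqnZ sqnJ nsqM nsq_real nc.
    have [->|nz] := eqVneq z 0; first by rewrite sqn0 mul0r divr_ge0 ?sqn_ge0.
    have np : sqn z != 0 by rewrite sqn_eq0.
    by rewrite le_eqVlt; apply/orP; left; apply/eqP; field; rewrite np sxn.
  apply: sqn_rank2_le => //.
  + by rewrite cmxZ dotZl dotZr pq' !mulr0.
  + by rewrite divr_ge0 ?sqn_ge0.
  + by rewrite scaleNr sqnN; apply: key.
Qed.

End MinimalMappings.

(** * Block columns and Kronecker products *)

Section Blocks.
Variables (R : realType) (n s : nat).
Local Notation C := R[i].

(** The selector of the block [i] of a stacked column. *)
Definition blk (i : 'I_s) : 'M[C]_(n, s * n) :=
  \matrix_(a, c) (mxtens_unindex c == (i, a))%:R.

Definition glue (x : 'I_s -> 'cV[C]_n) : 'cV[C]_(s * n) :=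
  \col_c x (mxtens_unindex c).1 (mxtens_unindex c).2 0.

Lemma blkE i p (V : 'M[C]_(s * n, p)) a j :
  (blk i *m V) a j = V (mxtens_index (i, a)) j.
Proof.
rewrite mxE (bigD1 (mxtens_index (i, a))) //= mxE mxtens_indexK eqxx mul1r.
rewrite big1 ?addr0 // => c ne; rewrite mxE (_ : _ == _ = false) ?mul0r //.
by apply: contraNF ne => /eqP <-; rewrite mxtens_unindexK.
Qed.

Lemma blk_glue i x : blk i *m glue x = x i.
Proof.
by apply/matrixP => a j; rewrite blkE mxE mxtens_indexK (ord1 j).
Qed.

Lemma sum_unindex (V : nmodType) (F : 'I_(s * n) -> V) :
  \sum_c F c = \sum_i \sum_a F (mxtens_index (i, a)).
Proof.
rewrite pair_big /= (reindex (@mxtens_index s n)) /=.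
  by apply: eq_bigr => -[].
by exists (@mxtens_unindex s n) => x _; rewrite ?mxtens_indexK ?mxtens_unindexK.
Qed.

Lemma sqn_blk v : sqn v = \sum_i sqn (blk i *m v).
Proof.
rewrite sqn_sum sum_unindex; apply: eq_bigr => i _.
by rewrite sqn_sum; apply: eq_bigr => a _; rewrite blkE.
Qed.

Lemma sqn_blk_le i v : sqn (blk i *m v) <= sqn v.
Proof.
rewrite [leRHS]sqn_blk (bigD1 i) //= lerDl sumr_ge0 // => j _; exact: sqn_ge0.
Qed.

(** Turns Kronecker products into ordinary products with selectors. *)
Lemma tensmx_blk (P : 'M[C]_s) (Q : 'M[C]_n) :
  P *t Q = \sum_i \sum_j P i j *: ((blk i)^T *m Q *m blk j).
Proof.
apply/matrixP => c c'; rewrite -(mxtens_unindexK c) -(mxtens_unindexK c').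
case: (mxtens_unindex c) (mxtens_unindex c') => [i a] [j b]; rewrite tensmxE.
rewrite summxE (bigD1 i) //= summxE (bigD1 j) //= big1 => [|j' ne]; last first.
  rewrite mxE mxE big1 ?mulr0 // => k _; rewrite [blk _ _ _]mxE mxtens_indexK.
  by rewrite xpair_eqE eq_sym (negbTE ne) mulr0.
rewrite big1 => [|i' ne]; last first.
  rewrite summxE big1 // => j' _; rewrite -mulmxA mxE mxE big1 ?mulr0 // => k _.
  by rewrite !mxE mxtens_indexK xpair_eqE eq_sym (negbTE ne) mul0r.
rewrite !addr0 mxE; congr (_ * _); rewrite -mulmxA mxE (bigD1 a) //= !mxE.
rewrite mxtens_indexK eqxx mul1r (bigD1 b) //= !mxE mxtens_indexK eqxx mulr1.
rewrite big1 => [|k ne]; last first.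
  by rewrite !mxE mxtens_indexK xpair_eqE eq_sym (negbTE ne) andbF mulr0.
rewrite big1 ?addr0 // => k ne.
by rewrite !mxE mxtens_indexK xpair_eqE eq_sym (negbTE ne) andbF mul0r.
Qed.

End Blocks.

Arguments blk {R} n {s} i.

(** * The Hermitian matrices F and their second largest eigenvalue *)

Section Pencil.
Variables (R : realType) (n s N : nat).
Local Notation C := R[i].
Variables (L : 'I_s -> C) (M : 'M[C]_n) (iota : 'I_N.+1 -> 'I_s).
Hypotheses (n_gt0 : (0 < n)%N) (s_gt0 : (0 < s)%N).
Local Notation E := (blk n).

Definition lincomb_mx : 'M[C]_(n, s * n) := \sum_i L i *: blk n i.
(** With [L] the row of weights and [M] the inverse of [G(lam)], this is the matrix
[B] that recovers [x] from the stacked products [Delta_i x]. *)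
Definition solve_mx : 'M[C]_(n, s * n) := M *m lincomb_mx.
Definition constraint_mx (i : 'I_s) : 'M[C]_(s * n) := solve_mx^T *m E i + (E i)^T *m solve_mx.
(** The matrix [f] of the theorem, but with a complex coefficient in front of every
[S_j]; a phase factor later makes the last one real. *)
Definition multiplier_mx (z : 'I_N.+1 -> C) : 'M[C]_(s * n) := \sum_j z j *: constraint_mx (iota j).
Definition direction z : 'M[C]_(s * n + s * n) :=
  block_mx 0 (cmx (multiplier_mx z)) (multiplier_mx z) 0.
(** The matrix [F] of the theorem. *)
Definition pencil z : 'M[C]_(s * n + s * n) :=
  block_mx (Defs.adjmx solve_mx *m solve_mx) (cmx (multiplier_mx z)) (multiplier_mx z)
    (cmx (Defs.adjmx solve_mx *m solve_mx)).
(** The value of the bilinear form [f] at [(a, b)], see [dot_multiplier_mx]. *)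
Definition coupling z (a b : 'cV[C]_(s * n)) : C := \sum_j z j *
  (dot (solve_mx *m b) (E (iota j) *m a) + dot (E (iota j) *m b) (solve_mx *m a)).

Let m_gt1 : (1 < s * n + s * n)%N.
Proof. by have : (0 < s * n)%N by [rewrite muln_gt0 s_gt0]; lia. Qed.

Lemma lincomb_mx_mulmx (v : 'cV[C]_(s * n)) : lincomb_mx *m v = \sum_i L i *: (E i *m v).
Proof. by rewrite mulmx_suml; apply: eq_bigr => i _; rewrite scalemxAl. Qed.

Lemma multiplier_mx_sym z : (multiplier_mx z)^T = multiplier_mx z.
Proof.
rewrite /multiplier_mx linear_sum; apply: eq_bigr => j _; rewrite linearZ /=.
by rewrite /constraint_mx [(_ + _)^T]linearD /= !trmx_mul !trmxK addrC.
Qed.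

Lemma dot_multiplier_mx z a b : dot b (multiplier_mx z *m a) = coupling z a b.
Proof.
rewrite /multiplier_mx /coupling /constraint_mx; move: solve_mx => B.
rewrite mulmx_suml dot_sumr; apply: eq_bigr => j _.
rewrite -scalemxAl dotZr; congr (_ * _); rewrite mulmxDl dotDr -!mulmxA.
by rewrite !(dot_mulmx _ b) !trmxK.
Qed.

Lemma col_mx_conj (w : 'cV[C]_(s * n + s * n)) : exists a b, w = col_mx a (cmx b).
Proof.
by exists (usubmx w), (cmx (dsubmx w)); rewrite cmxK vsubmxK.
Qed.

Lemma cmx_col_mx p q r (A : 'M[C]_(p, r)) (B : 'M[C]_(q, r)) :
  cmx (col_mx A B) = col_mx (cmx A) (cmx B).
Proof. exact: map_col_mx. Qed.

Lemma dot_col_mx p q (a c : 'cV[C]_p) (b d : 'cV[C]_q) :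
  dot (col_mx a b) (col_mx c d) = dot a c + dot b d.
Proof. by rewrite /dot tr_col_mx mul_row_col mxE. Qed.

Lemma coupling_sym z a b : coupling z a b = coupling z b a.
Proof.
rewrite /coupling; apply: eq_bigr => j _; rewrite addrC.
by congr (_ * (_ + _)); apply: dotC.
Qed.

Lemma qf_direction z a b :
  qf (direction z) (col_mx a (cmx b)) = 2 * complex.Re (coupling z a b).
Proof.
rewrite /qf /direction mul_block_col !mul0mx add0r addr0 cmx_col_mx dot_col_mx.
by rewrite cmxK -cmxM -conj_dot ReD ReJ !dot_multiplier_mx coupling_sym mulr_natl mulr2n.
Qed.

Lemma pencilE z : pencil z = pencil (fun=> 0) + direction z.
Proof.
rewrite /pencil /direction add_block_mx !addr0.
suff -> : multiplier_mx (fun=> 0) = 0 by rewrite cmx0 !add0r.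
by rewrite /multiplier_mx big1 // => j _; rewrite scale0r.
Qed.

Lemma qf_pencil z a b : qf (pencil z) (col_mx a (cmx b)) =
  sqn (solve_mx *m a) + sqn (solve_mx *m b) + 2 * complex.Re (coupling z a b).
Proof.
rewrite pencilE qfD qf_direction; congr (_ + _).
have f0 : multiplier_mx (fun=> 0) = 0 by rewrite /multiplier_mx big1 // => j _; rewrite scale0r.
rewrite /qf /pencil f0 cmx0 mul_block_col !mul0mx addr0 add0r.
rewrite cmx_col_mx dot_col_mx cmxK -cmxM ReD.
have J x : dot (cmx x) (Defs.adjmx solve_mx *m solve_mx *m x) = (sqn (solve_mx *m x))%:C.
  move: solve_mx => B.
  by rewrite -mulmxA dot_adj /Defs.adjmx cmx_tr cmxK trmxK sqnE.
by rewrite J /= -ReJ conj_dot cmxK J.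
Qed.

Lemma adjmx_block p q (A : 'M[C]_p) B D (F : 'M[C]_q) :
  Defs.adjmx (block_mx A B D F) = block_mx (Defs.adjmx A) (Defs.adjmx D) (Defs.adjmx B) (Defs.adjmx F).
Proof. by rewrite /Defs.adjmx /cmx map_block_mx tr_block_mx. Qed.

Lemma direction_adj z : Defs.adjmx (direction z) = direction z.
Proof.
rewrite adjmx_block /direction /Defs.adjmx cmxK multiplier_mx_sym -!cmx_tr multiplier_mx_sym.
by rewrite !(cmx0, trmx0).
Qed.

Lemma pencil_adj z : Defs.adjmx (pencil z) = pencil z.
Proof.
have J : Defs.adjmx (Defs.adjmx solve_mx *m solve_mx) = Defs.adjmx solve_mx *m solve_mx.
  by rewrite /Defs.adjmx cmxM cmx_tr trmx_mul cmxK trmxK.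
rewrite adjmx_block /pencil; congr block_mx => //.
- by rewrite /Defs.adjmx -cmx_tr multiplier_mx_sym.
- by rewrite /Defs.adjmx cmxK multiplier_mx_sym.
- by rewrite -[in RHS]J /Defs.adjmx -!cmx_tr.
Qed.

Lemma direction_line z z' (e : R) :
  pencil z + e%:C *: direction z' = pencil (fun j => z j + e%:C * z' j).
Proof.
rewrite pencilE [RHS]pencilE -addrA; congr (_ + _).
rewrite /direction scale_block_mx add_block_mx !scaler0 !addr0.
suff -> : multiplier_mx (fun j => z j + e%:C * z' j) = multiplier_mx z + e%:C *: multiplier_mx z'.
  by rewrite cmxD cmxZ conjR.
rewrite /multiplier_mx scaler_sumr -big_split; apply: eq_bigr => j _.
by rewrite scalerDl scalerA.
Qed.

(** The relations [x^T v_i = 0] imposed by the skew coefficients, for [x = B v]. *)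
Definition feasible v := forall j, dot (solve_mx *m v) (E (iota j) *m v) = 0.

Lemma coupling_feasible z v a b : feasible v -> coupling z (a *: v) (b *: v) = 0.
Proof.
move=> fv; apply: big1 => j _; rewrite -!scalemxAr !(dotZl, dotZr).
by rewrite (dotC (E _ *m v)) fv !mulr0 addr0 mulr0.
Qed.

(** On the plane spanned by [(v, 0)] and [(0, conj v)] the coupling vanishes, and
the form is a multiple of the squared norm. *)
Lemma feasible_le z v : v != 0 -> feasible v ->
  sqn (solve_mx *m v) / sqn v <= lambda2 (pencil z).
Proof.
move=> v0 fv; have sv : 0 < sqn v by rewrite sqn_gt0.
have YE a b : a *: col_mx v 0 + b *: col_mx 0 (cmx v) =
    col_mx (a *: v) (cmx (b^* *: v)).
  by rewrite !scale_col_mx add_col_mx !scaler0 addr0 add0r cmxZ conjcK.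
apply: (@lambda2_ge_plane _ _ _ (col_mx v 0) (col_mx 0 (cmx v))) => //.
- exact: pencil_adj.
- move=> a b; rewrite YE => h.
  have : sqn (col_mx (a *: v) (cmx (b^* *: v))) = 0 by rewrite h sqn0.
  rewrite sqn_col_mx sqnJ !sqnZ nsqJ -mulrDl => /eqP.
  rewrite mulf_eq0 (gt_eqF sv) orbF paddr_eq0 ?nsq_ge0 // !nsq_eq0.
  by move=> /andP[/eqP -> /eqP ->].
- move=> a b; rewrite YE qf_pencil coupling_feasible //= mulr0 addr0.
  rewrite sqn_col_mx sqnJ -!scalemxAr !sqnZ nsqJ -!mulrDl.
  by rewrite mulrCA divfK // gt_eqF.
Qed.

(** Test vectors: [p] has the blocks [y] at [iota j] and [- (L_(iota j) / L_q) y] at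
[q], so that [B p = 0]; [r] has a single block at [q], chosen so that [B r] is a
multiple of [conj y]. On the plane spanned by [(p, conj (t r))] and [(r, conj (t p))]
only the product of [B r] with the block [iota j] of [p] couples to [z], since
the coefficient at [q] vanishes, and the phase [t] makes it positive. The form
there is thus at least [2 |z_j| |L_q|] times the squared norm of the coordinates. *)
Lemma pencil_coercive q j : injective iota -> (forall i, L i != 0) ->
  M \in unitmx -> iota j != q ->
  exists2 k : R, 0 < k & forall z, (forall l, iota l = q -> z l = 0) ->
    z j != 0 -> k * Normc.normc (z j) <= lambda2 (pencil z).
Proof.
move=> inj L0 Mu jq; have [y y1] := unit_vector_exists R n_gt0.
pose p : 'cV[C]_(s * n) := glue (fun i => if i == iota j then y
   else if i == q then - (L (iota j) / L q) *: y else 0).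
pose r : 'cV[C]_(s * n) := glue (fun i => if i == q then invmx M *m cmx y else 0).
have Bp : solve_mx *m p = 0.
  rewrite /solve_mx -mulmxA lincomb_mx_mulmx (bigD1 (iota j)) //= (bigD1 q) 1?eq_sym //=.
  rewrite big1 => [|i /andP[n1 n2]]; last first.
    by rewrite blk_glue (negbTE n1) (negbTE n2) scaler0.
  rewrite !blk_glue eqxx eq_sym (negbTE jq) eqxx addr0 scalerA mulrN mulrC.
  by rewrite divfK // scaleNr subrr mulmx0.
have Br : solve_mx *m r = L q *: cmx y.
  rewrite /solve_mx -mulmxA lincomb_mx_mulmx (bigD1 q) //= big1 => [|i ne]; last first.
    by rewrite blk_glue (negbTE ne) scaler0.
  by rewrite blk_glue eqxx addr0 -scalemxAr mulKVmx.
pose K := sqn p + sqn r.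
have r0 : r != 0.
  apply/eqP => h; move: Br; rewrite h mulmx0 => /esym/eqP.
  rewrite scaler_eq0 (negbTE (L0 q)) /= -sqn_eq0 sqnJ y1.
  by rewrite oner_eq0.
have K0 : 0 < K by rewrite ltr_wpDl ?sqn_ge0 ?sqn_gt0.
have nL : 0 < Normc.normc (L q) by rewrite normc_gt0.
exists (Normc.normc (L q) / K); first exact: divr_gt0.
move=> z zq zj.
have nz : 0 < Normc.normc (z j) by rewrite normc_gt0.
have [t t1 ht] := phase_exists (z j * L q).
pose w1 := col_mx p (cmx (t *: r)); pose w2 := col_mx r (cmx (t *: p)).
have YE a b : a *: w1 + b *: w2 =
    col_mx (a *: p + b *: r) (cmx (t *: (a^* *: r + b^* *: p))).
  rewrite !scale_col_mx add_col_mx; congr col_mx.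
  by rewrite !cmxZ cmxD !cmxZ !conjcK scalerDr !scalerA ![t^* * _]mulrC.
set g := Normc.normc (z j) * Normc.normc (L q).
have g0 : 0 < g by apply: mulr_gt0.
have QE a b : 2 * (nsq a + nsq b) * g <= qf (pencil z) (a *: w1 + b *: w2).
  rewrite YE qf_pencil.
  suff -> : coupling z (a *: p + b *: r) (t *: (a^* *: r + b^* *: p)) =
     ((nsq a + nsq b) * g)%:C.
    rewrite /= -mulrA lerDr addr_ge0 ?sqn_ge0 //.
  have Ba : solve_mx *m (a *: p + b *: r) = b *: (solve_mx *m r).
    by rewrite mulmxDr -!scalemxAr Bp scaler0 add0r.
  have Bb : solve_mx *m (t *: (a^* *: r + b^* *: p)) = (t * a^*) *: (solve_mx *m r).
    by rewrite -scalemxAr mulmxDr -!scalemxAr Bp scaler0 addr0 scalerA.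
  have Ea l : E l *m (a *: p + b *: r) = a *: (E l *m p) + b *: (E l *m r).
    by rewrite mulmxDr -!scalemxAr.
  have Eb l : E l *m (t *: (a^* *: r + b^* *: p)) =
      (t * a^*) *: (E l *m r) + (t * b^*) *: (E l *m p).
    by rewrite -scalemxAr mulmxDr -!scalemxAr scalerDr !scalerA.
  have zr l : z l * dot (solve_mx *m r) (E (iota l) *m r) = 0.
    have [e|ne] := eqVneq (iota l) q; first by rewrite zq // mul0r.
    by rewrite blk_glue (negbTE ne) dot0r mulr0.
  have zp l : z l * dot (solve_mx *m r) (E (iota l) *m p) = (l == j)%:R * (z j * L q).
    have [->|ne] := eqVneq l j.
      by rewrite blk_glue eqxx Br dotZl -sqnE y1 mulr1 mul1r.
    rewrite mul0r blk_glue (inj_eq inj) (negbTE ne).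
    by case: eqP => e; [rewrite zq // mul0r | rewrite dot0r mulr0].
  (* Every product with [B r] at the blocks of [r] is killed by [zr]. *)
  transitivity (\sum_l (t * (a^* * a + b^* * b)) *
        (z l * dot (solve_mx *m r) (E (iota l) *m p))).
    apply: eq_bigr => l _; rewrite Ba Bb Ea Eb !(dotZl, dotZr, dotDl, dotDr).
    rewrite !(dotC (E _ *m _)).
    set u := dot _ (_ *m p); set v := dot _ (_ *m r).
    have zv : z l * v = 0 by apply: zr.
    transitivity (t * (a^* * a + b^* * b) * (z l * u) + 2 * t * a^* * b * (z l * v)).
      by ring.
    by rewrite zv mulr0 addr0.
  rewrite (bigD1 j) //= big1 => [|l ne]; last by rewrite zp (negbTE ne) mul0r mulr0.
  rewrite zp eqxx mul1r addr0 rmorphM rmorphD /= !nsqE /g -Normc.normcM -ht.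
  by ring.
apply: (@lambda2_ge_plane _ _ _ w1 w2) => //.
- exact: pencil_adj.
- move=> a b h; have := QE a b; rewrite h /qf mulmx0 dot0r /= => h1.
  have : nsq a + nsq b <= 0 by rewrite -(pmulr_lle0 _ g0); nra.
  have := nsq_ge0 a; have := nsq_ge0 b => h2 h3 h4.
  by split; apply/eqP; rewrite -nsq_eq0; apply/eqP; lra.
- move=> a b; apply: le_trans (QE a b).
  have h : sqn (a *: w1 + b *: w2) <= 2 * ((nsq a + nsq b) * K).
    rewrite YE sqn_col_mx sqnJ sqnZ t1 mul1r.
    have := sqnD_le (a *: p) (b *: r); have := sqnD_le (a^* *: r) (b^* *: p).
    rewrite !sqnZ !nsqJ /K; lra.
  have gK : 0 <= g / K by rewrite divr_ge0 ?ltW.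
  have -> : Normc.normc (L q) / K * Normc.normc (z j) = g / K.
    by rewrite /g; field; apply: lt0r_neq0.
  apply: le_trans (ler_wpM2l gK h) _.
  rewrite le_eqVlt; apply/orP; left; apply/eqP; field; exact: lt0r_neq0.
Qed.

Lemma pencil_lipschitz : exists2 K : R, 0 <= K & forall z z',
  lambda2 (pencil z') <= lambda2 (pencil z) + K * \sum_j Normc.normc (z' j - z j).
Proof.
have [K K0 hK] := sqn_mulmx_bounded solve_mx; exists (2 * (K + 1)); first lra.
move=> z z'; apply: (@lambda2_le _ _ _ _ 1%:M) => //; try exact: pencil_adj.
  by move=> y; rewrite mul1mx.
move=> w; rewrite mul1mx; have [a [b ->]] := col_mx_conj w.
rewrite !qf_pencil sqn_col_mx sqnJ.
have -> : coupling z' a b = coupling z a b + coupling (fun j => z' j - z j) a b.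
  by rewrite -big_split; rewrite /coupling; apply: eq_bigr => j _ /=; rewrite -mulrDl; congr (_ * _); ring.
suff : complex.Re (coupling (fun j => z' j - z j) a b) <=
    (K + 1) * (\sum_j Normc.normc (z' j - z j)) * (sqn a + sqn b).
  rewrite ReD; lra.
rewrite Re_sum mulr_sumr mulr_suml; apply: ler_sum => j _.
apply: le_trans (Re_mul_le _ _) _; rewrite [(K + 1) * _]mulrC -mulrA.
apply: ler_wpM2l; first exact: normc_ge0.
apply: le_trans (le_normcD _ _) _.
have := normc_dot (solve_mx *m b) (E (iota j) *m a).
have := normc_dot (E (iota j) *m b) (solve_mx *m a).
have := hK a; have := hK b; have := sqn_blk_le (iota j) a.
have := sqn_blk_le (iota j) b; lra.
Qed.

(** [diag(t I, I)] is unitary, and conjugation by it multiplies [f] by [t]. *)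
Lemma pencil_rotate t z : nsq t = 1 ->
  lambda2 (pencil (fun j => t * z j)) <= lambda2 (pencil z).
Proof.
move=> t1; rewrite -[leRHS]addr0.
pose T : 'M[C]_(s * n + s * n) := block_mx (t%:M) 0 0 1%:M.
have TE a b : T *m col_mx a b = col_mx (t *: a) b.
  by rewrite mul_block_col !mul0mx addr0 add0r mul1mx mul_scalar_mx.
apply: (@lambda2_le _ _ _ _ T) => //; try exact: pencil_adj.
  move=> w; have [a [b ->]] := col_mx_conj w.
  by rewrite TE !sqn_col_mx sqnZ t1 mul1r.
move=> w; have [a [b ->]] := col_mx_conj w.
rewrite TE !qf_pencil mul0r addr0 -scalemxAr sqnZ t1 mul1r lerD2l.
rewrite le_eqVlt; apply/orP; left; apply/eqP; congr (_ * complex.Re _).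
rewrite /coupling; apply: eq_bigr => j _; rewrite -!scalemxAr !dotZr.
ring.
Qed.

(** If every position is constrained and [M] is skew, then
[sum_j L_(iota j) S_j = S^T (M^T + M) S = 0] with [S = lincomb_mx]. *)
Lemma pencil_shift c z : injective iota -> (forall i, exists j, iota j = i) ->
  M^T = - M -> pencil (fun j => z j + c * L (iota j)) = pencil z.
Proof.
move=> inj surj skewM.
suff e : multiplier_mx (fun j => z j + c * L (iota j)) = multiplier_mx z.
  by rewrite /pencil e.
have -> : multiplier_mx (fun j => z j + c * L (iota j)) =
   multiplier_mx z + c *: \sum_j L (iota j) *: constraint_mx (iota j).
  rewrite /multiplier_mx scaler_sumr -big_split; apply: eq_bigr => j _.
  by rewrite scalerDl scalerA.
suff -> : \sum_j L (iota j) *: constraint_mx (iota j) = 0 by rewrite scaler0 addr0.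
have bij : bijective iota.
  apply: inj_card_bij => //; apply: leq_card (fun i => xchoose (_ : exists j, iota j == i)) _.
    by move=> i; have [j <-] := surj i; exists j.
  move=> h i i' e; rewrite -(eqP (xchooseP (h i))) e; exact: (eqP (xchooseP (h i'))).
have [k ik ki] := bij.
have <- : \sum_i L i *: constraint_mx i = \sum_j L (iota j) *: constraint_mx (iota j).
  by rewrite (reindex iota) //=; exists k => x _.
have -> : \sum_i L i *: constraint_mx i = solve_mx^T *m lincomb_mx + (lincomb_mx)^T *m solve_mx.
  rewrite /lincomb_mx mulmx_sumr [X in X *m solve_mx]linear_sum mulmx_suml -big_split /=.
  apply: eq_bigr => i _; rewrite /constraint_mx scalerDr -scalemxAr; congr (_ + _).
  by rewrite linearZ /= -scalemxAl.
by rewrite /solve_mx trmx_mul skewM mulmxN mulNmx mulmxA addNr.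
Qed.

(** Reduction to a compact box: after pinning the coordinate [q], coercivity bounds
all other coordinates on the set where the value does not exceed the one at [0]. *)
Lemma pencil_min : injective iota -> (forall i, L i != 0) -> M \in unitmx ->
  ((forall i, exists j, iota j = i) -> M^T = - M) ->
  exists z0, forall z, lambda2 (pencil z0) <= lambda2 (pencil z).
Proof.
move=> inj L0 Mu skewM.
have [q hq] : exists q, forall z, exists2 z', pencil z' = pencil z &
    forall l, iota l = q -> z' l = 0.
  have [[q qn]|surj] := pselect (exists q, forall j, iota j <> q).
    by exists q => z; exists z => // l /qn.
  have sj i : exists j, iota j = i.
    apply: contrapT => h; apply: surj; exists i => j e; apply: h; by exists j.
  exists (iota ord0) => z; pose c := - (z ord0 / L (iota ord0)).
  exists (fun j => z j + c * L (iota j)); first exact: pencil_shift (skewM sj).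
  by move=> l /inj ->; rewrite mulNr divfK // subrr.
pose c0 := lambda2 (pencil (fun=> 0)).
have bnd l : exists f : R, 0 <= f /\ forall z, (forall j, iota j = q -> z j = 0) ->
    lambda2 (pencil z) <= c0 -> Normc.normc (z l) <= f.
  have [e|ne] := eqVneq (iota l) q.
    by exists 0; split=> // z hz _; rewrite hz // Normc.normc0.
  have [k k0 hk] := pencil_coercive inj L0 Mu ne.
  exists (`|c0| / k); split; first by rewrite divr_ge0 // ltW.
  move=> z hz hc; have [->|zl] := eqVneq (z l) 0.
    by rewrite Normc.normc0 divr_ge0 // ltW.
  rewrite ler_pdivlMr // mulrC; apply: le_trans (hk z hz zl) _.
  exact: le_trans hc (ler_norm _).
have [f hf] := choice bnd.
pose K := \sum_l f l.
have fK l : f l <= K.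
  by rewrite /K (bigD1 l) //= lerDl sumr_ge0 // => j _; case: (hf j).
pose zt (t : 'rV[R]_(N.+1 + N.+1)) l : C := if iota l == q then 0
   else t 0 (lshift _ l) +i* t 0 (rshift _ l).
pose A := [set t : 'rV[R]_(N.+1 + N.+1) | forall i, `[-K, K]%classic (t ord0 i)]%classic.
have K0 : 0 <= K by apply: sumr_ge0 => l _; case: (hf l).
have cA : compact A.
  by apply: (rV_compact (A := fun=> `[-K, K]%classic)) => i; apply: segment_compact.
have A0 : A (0 : 'rV[R]_(N.+1 + N.+1)).
  by move=> i /=; rewrite mxE in_itv /=; apply/andP; split; lra.
(* [zt] ignores the two real coordinates of a pinned coefficient. *)
pose phi t := lambda2 (pencil (zt t)).
have cphi : continuous phi.
  have [Q Q0 hQ] := pencil_lipschitz.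
  have lip (t t' : 'rV[R]_(N.+1 + N.+1)) (d : R) : 0 < d ->
      (forall i, `|t 0 i - t' 0 i| < d) -> phi t <= phi t' + Q * (d *+ 2 *+ N.+1).
    move=> d0 h; apply: le_trans (hQ (zt t') (zt t)) _.
    rewrite lerD2l ler_wpM2l //.
    rewrite -[N.+1 in leRHS]card_ord -sumr_const; apply: ler_sum => l _.
    rewrite /zt; case: ifP => _; first by rewrite subrr Normc.normc0 mulrn_wge0 ?ltW.
    have h1 := h (lshift _ l); have h2 := h (rshift _ l).
    apply: normc_nsq; first by rewrite mulrn_wge0 ?ltW.
    move: h1 h2; rewrite /nsq /= !ltr_norml => /andP[a1 a2] /andP[b1 b2].
    nra.
  move=> t; apply/(@cvgrPdist_le _ _ _ (nbhs t) (nbhs_filter t) phi (phi t)) => e e0.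
  pose d := e / (Q *+ 2 *+ N.+1 + 1).
  have D0 : 0 <= Q *+ 2 *+ N.+1 by rewrite !mulrn_wge0.
  have d0 : 0 < d by rewrite divr_gt0 //; lra.
  have dQ : Q * (d *+ 2 *+ N.+1) <= e.
    have -> : Q * (d *+ 2 *+ N.+1) = (Q *+ 2 *+ N.+1) * d.
      by rewrite !mulrnAr !mulrnAl.
    rewrite /d mulrA ler_pdivrMr; nra.
  apply/nbhs_ballP; exists d => //= t' ht.
  have h i : `|t 0 i - t' 0 i| < d by apply: (ht.2 0 i).
  have h' i : `|t' 0 i - t 0 i| < d by rewrite distrC.
  rewrite ler_distl; apply/andP; split.
    by rewrite lerBlDr (le_trans (lip _ _ _ d0 h')) // lerD2l.
  by rewrite (le_trans (lip _ _ _ d0 h)) // lerD2l.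
have [t _ ht] := compact_EVT_min (ex_intro _ _ A0) cA (continuous_subspaceT cphi).
exists (zt t) => z.
have [z' <- z'q] := hq z.
have [hz|hz] := leP (lambda2 (pencil z')) c0; last first.
  apply: le_trans (ltW hz); have := ht _ (mem_set A0); rewrite {2}/phi.
  suff -> : zt 0 = fun=> 0 by [].
  by apply/funext => l; rewrite /zt !mxE; case: ifP.
pose t' : 'rV[R]_(N.+1 + N.+1) :=
  row_mx (\row_l complex.Re (z' l)) (\row_l complex.Im (z' l)).
have <- : zt t' = z'.
  apply/funext => l; rewrite /zt row_mxEl row_mxEr !mxE; case: eqP => [/z'q -> //|_].
  by case: (z' l).
apply: ht; apply/mem_set => i.
have zK l : Normc.normc (z' l) <= K by apply: le_trans (fK l); apply: (hf l).2.
have abs_le (a b : R) : Num.sqrt (a ^+ 2 + b ^+ 2) <= K -> -K <= a <= K /\ -K <= b <= K.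
  move=> h; have a0 := sqr_ge0 a; have b0 := sqr_ge0 b.
  have h1 : `|a| <= K.
    by apply: le_trans h; rewrite -sqrtr_sqr ler_wsqrtr // lerDl.
  have h2 : `|b| <= K.
    by apply: le_trans h; rewrite -sqrtr_sqr ler_wsqrtr // lerDr.
  by rewrite -!ler_norml.
rewrite /= in_itv /= /t'; case: (split_ordP i) => l ->.
  rewrite row_mxEl mxE; have := zK l; case: (z' l) => a b /=.
  by move=> /abs_le [].
rewrite row_mxEr mxE; have := zK l; case: (z' l) => a b /=.
by move=> /abs_le [].
Qed.

(** Conjugating the two block equations exchanges them. *)
Lemma pencil_swap z (l : R) (a b : 'cV[C]_(s * n)) :
  pencil z *m col_mx a (cmx b) = l%:C *: col_mx a (cmx b) ->
  pencil z *m col_mx b (cmx a) = l%:C *: col_mx b (cmx a).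
Proof.
rewrite !mul_block_col !scale_col_mx => /eq_col_mx [e1 e2].
move: (congr1 (@cmx R _ _) e1) (congr1 (@cmx R _ _) e2).
rewrite !cmxD !cmxM !cmxK !cmxZ !conjR !cmxK => f1 f2.
by congr col_mx; rewrite addrC // -f1 addrC.
Qed.

(** By simplicity the swapped eigenvector is [c] times the original one, so its second
block is the conjugate of [c a]. The derivative of the form in the direction
[z' = zeta e_j] is then [4 Re (zeta c (B a . E_j a))]; it is nonnegative for all
complex [zeta] only if [B a . E_j a = 0]. *)
Lemma optimal_feasible z : (forall z', lambda2 (pencil z) <= lambda2 (pencil z')) ->
  simple_eigenvalue (pencil z) (lambda2 (pencil z))%:C ->
  exists v, [/\ v != 0, feasible v & sqn (solve_mx *m v) = lambda2 (pencil z) * sqn v].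
Proof.
move=> zmin simple; set l := lambda2 _ in zmin simple *.
have [w [w0 ew uniq dec]] := simple_lambda2 m_gt1 (pencil_adj z) simple.
have [a [b wE]] := col_mx_conj w; rewrite {w}wE in w0 ew uniq dec.
have [c] := uniq _ (pencil_swap ew).
rewrite scale_col_mx => /eq_col_mx [bE aE].
have a0 : a != 0.
  apply: contra w0 => /eqP h; rewrite bE h scaler0 cmx0 -col_mx0 //.
(* Swapping twice multiplies the norm by [|c|^2]. *)
have c1 : nsq c = 1.
  have : sqn a = nsq c * sqn b by rewrite -sqnJ aE sqnZ sqnJ.
  rewrite bE sqnZ mulrA -expr2 => h.
  have sa : sqn a != 0 by rewrite sqn_eq0.
  have : nsq c ^+ 2 = 1 by apply: (mulIf sa); rewrite -h mul1r.
  by move/eqP; rewrite sqrf_eq1 => /orP[/eqP//|/eqP e]; have := nsq_ge0 c; rewrite e; lra.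
have fa : feasible a.
  move=> j; set g := dot _ _; pose z' l : C := if l == j then - (c * g)^* else 0.
  have q : qf (direction z') (col_mx a (cmx b)) = - 4 * nsq (c * g).
    rewrite qf_direction /coupling (bigD1 j) //= big1 => [|i /negbTE ne]; last first.
      by rewrite /z' ne mul0r.
    rewrite addr0 /z' eqxx bE -!scalemxAr !dotZl (dotC (E _ *m a)) -/g.
    by case: (c * g) => x y; rewrite /nsq /=; ring.
  apply/eqP; rewrite -nsq_eq0 -[X in X == _]mul1r -c1 -nsqM; apply/negPn/negP => ne.
  have skew_nat : 0 < nsq (c * g) by rewrite lt_def ne nsq_ge0.
  have [|e e0] := dec _ (direction_adj z'); first by rewrite q; lra.
  by rewrite direction_line ltNge zmin.
exists a; split=> //.
have := qf_eigen ew; rewrite qf_pencil bE.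
have -> : coupling z a (c *: a) = 0 by rewrite -{1}[a]scale1r coupling_feasible.
rewrite /= mulr0 addr0 sqn_col_mx sqnJ -scalemxAr !sqnZ c1 !mul1r mulrDr -/l; move: (l * _) => r h; lra.
Qed.

End Pencil.

(** * Positions of the skew-symmetric coefficients *)

Section Translation.
Variables (R : realType) (n d k : nat) (G : rmp R n d k) (lam : R[i]).
Local Notation C := R[i].
Local Notation s := (d.+1 + k)%N.

Definition coef (D : coefs R n d k) (i : 'I_s) : 'M[C]_n :=
  match split i with inl p => D.1 p | inr j => D.2 j end.

Definition Lam (i : 'I_s) : C := Lambda G lam 0 i.

Definition skew_index (i : 'I_s) : bool :=
  match split i with inl p => ~~ odd p | inr j => `[< weight_even G j >] end.

Lemma split_l (p : 'I_d.+1) : split (lshift k p) = inl p.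
Proof. exact: (unsplitK (inl p)). Qed.
Lemma split_r (j : 'I_k) : split (rshift d.+1 j) = inr j.
Proof. exact: (unsplitK (inr j)). Qed.

Lemma skew_index_l p : skew_index (lshift k p) = ~~ odd p.
Proof. by rewrite /skew_index split_l. Qed.
Lemma skew_index_r j : skew_index (rshift d.+1 j) = `[< weight_even G j >].
Proof. by rewrite /skew_index split_r. Qed.

Lemma coef_l D p : coef D (lshift k p) = D.1 p.
Proof. by rewrite /coef split_l. Qed.
Lemma coef_r D j : coef D (rshift d.+1 j) = D.2 j.
Proof. by rewrite /coef split_r. Qed.
Lemma Lam_l p : Lam (lshift k p) = lam ^+ p.
Proof. by rewrite /Lam /Lambda row_mxEl mxE. Qed.
Lemma Lam_r j : Lam (rshift d.+1 j) = weight G j lam.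
Proof. by rewrite /Lam /Lambda row_mxEr mxE. Qed.

Lemma weighted_sum_coef D : weighted_sum G D lam = \sum_i Lam i *: coef D i.
Proof.
rewrite big_split_ord /weighted_sum /=; congr (_ + _); apply: eq_bigr => i _.
  by rewrite Lam_l coef_l.
by rewrite Lam_r coef_r.
Qed.

Lemma sum_coef (F : 'M[C]_n -> R) D :
  \sum_i F (coef D i) = \sum_(p < d.+1) F (D.1 p) + \sum_(j < k) F (D.2 j).
Proof.
rewrite big_split_ord /=; congr (_ + _); apply: eq_bigr => i _.
  by rewrite coef_l.
by rewrite coef_r.
Qed.

Lemma tuple_norm_coef D :
  tuple_norm D = Num.sqrt (\sum_i spectral_norm (coef D i) ^+ 2).
Proof. by rewrite (sum_coef (fun A => spectral_norm A ^+ 2)). Qed.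

Lemma weighted_sum_sub D D' :
  weighted_sum G (coefs_sub D D') lam = weighted_sum G D lam - weighted_sum G D' lam.
Proof.
rewrite /weighted_sum /coefs_sub /= opprD addrACA -!sumrB.
by congr (_ + _); apply: eq_bigr => i _; rewrite scalerBr.
Qed.

Hypotheses (hlam : lam <> 0) (hw : forall j, weight G j lam <> 0).

Lemma Lam_neq0 i : Lam i != 0.
Proof.
case: (split_ordP i) => j ->; first by rewrite Lam_l expf_neq0 //; apply/eqP.
by rewrite Lam_r; apply/eqP.
Qed.

Lemma nonroot_exists (p : {poly C}) : p != 0 -> exists z, ~~ root p z.
Proof.
move=> p0; apply: contrapT => h.
pose rs : seq C := [seq i%:R | i <- iota 0 (size p)].
have : (size rs < size p)%N.
  apply: max_poly_roots => //.
    by apply/allP => z _; apply: contrapT => hz; apply: h; exists z; apply/negP.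
  by rewrite map_inj_uniq ?iota_uniq // => i j /eqP; rewrite eqr_nat => /eqP.
by rewrite size_map size_iota ltnn.
Qed.

(** A weight of both parities vanishes off finitely many points; its numerator is
then the zero polynomial, against [weight G j lam <> 0]. *)
Lemma even_not_odd j : weight_even G j -> weight_odd G j -> False.
Proof.
move=> ev od; pose q := rmp_num G j * rmp_den G j * (rmp_den G j \Po (- 'X)).
have [q0|q0] := eqVneq q 0.
  move: q0; rewrite /q => /eqP; rewrite !mulf_eq0 (negbTE (rmp_den_neq0 G j)) orbF.
  rewrite comp_poly2_eq0 ?size_polyN ?size_polyX // (negbTE (rmp_den_neq0 G j)) orbF.
  by move=> /eqP h; apply: (hw (j := j)); rewrite /weight h horner0 mul0r.
have [z] := nonroot_exists q0; rewrite /q !rootM !negb_or => /andP[/andP[z1 z2]].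
rewrite /root horner_comp hornerN hornerX -/(root _ _) => z3.
have := ev z z2 z3; rewrite (od z z2 z3) => /eqP.
rewrite eq_sym -addr_eq0 -mulr2n mulrn_eq0 /= /weight mulf_eq0 invr_eq0.
by rewrite -!/(root _ _) (negbTE z1) (negbTE z2).
Qed.

Hypothesis hparity : forall j, weight_even G j \/ weight_odd G j.

(** Each coefficient has exactly one of the two symmetries; for the [E_j] this rests
on the exclusiveness of the two parities. *)
Lemma oddT_setP D : oddT_set G D <->
  forall i, (coef D i)^T = if skew_index i then - coef D i else coef D i.
Proof.
split=> [[h1 h2 h3] i|h].
  case: (split_ordP i) => j ->; rewrite /skew_index.
    rewrite coef_l split_l h1 -signr_odd /=.
    by case: odd; rewrite /= ?expr0 ?expr1 ?scale1r ?scaleN1r.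
  rewrite coef_r split_r; case: asboolP => [/h3 //|ne].
  by case: (hparity j) => [/ne //|/h2].
split=> [p|j oj|j ej].
- have := h (lshift k p); rewrite /skew_index coef_l split_l => ->.
  rewrite -signr_odd /=.
  by case: odd; rewrite /= ?expr0 ?expr1 ?scale1r ?scaleN1r.
- have := h (rshift d.+1 j); rewrite /skew_index coef_r split_r.
  by case: asboolP => // ej; case: (even_not_odd ej oj).
- have := h (rshift d.+1 j); rewrite /skew_index coef_r split_r.
  by case: asboolP.
Qed.

Local Notation EV := [set j : 'I_k | `[< weight_even G j >]].

Lemma num_odd_even : (num_odd G + #|EV| = k)%N.
Proof.
rewrite /num_odd addnC -[RHS]card_ord -(cardsC EV); congr (_ + _)%N.
apply: eq_card => j; rewrite !inE; apply/asboolP/negP.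
  by move=> oj /asboolP ej; apply: even_not_odd ej oj.
by move=> ne; case: (hparity j) => // ej; case: ne; apply/asboolP.
Qed.

Lemma bigN_even : bigN G = (half_deg d + #|EV|)%N.
Proof. by rewrite /bigN; have := num_odd_even; lia. Qed.

(** Indexed from [0], while the values remain 1-based. *)
Definition even_pos (l : nat) : nat := nth 0%N (even_indices G) l.

Lemma even_posP l : (l < #|EV|)%N ->
  exists j : 'I_k, [/\ even_pos l = j.+1, weight_even G j & l = index j (enum EV)].
Proof.
move=> hl; have k0 : (0 < k)%N by have := num_odd_even; lia.
pose j0 := Ordinal k0; exists (nth j0 (enum EV) l).
have hl' : (l < size (enum EV))%N by rewrite -cardE.
split.
- by rewrite /even_pos /even_indices (nth_map j0).
- by have := mem_nth j0 hl'; rewrite mem_enum inE => /asboolP.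
- by rewrite index_uniq ?enum_uniq.
Qed.

Lemma double_half_deg : (2 * half_deg d <= d)%N.
Proof. by rewrite mul2n /half_deg -{2}(odd_double_half d) leq_addl. Qed.

(** The first [m + 1] constraints come from the even powers of [lam], the others from
the even weights; [even_pos] is 1-based, which accounts for [d] where the offset
of the [E_j] is [d + 1]. *)
Definition skew_nat (j : nat) : nat :=
  if (j <= half_deg d)%N then (2 * j)%N
  else (d + even_pos (j - (half_deg d).+1))%N.

Definition skew_pos (j : 'I_(bigN G).+1) : 'I_s := (inord (skew_nat j) : 'I_(d + k).+1).

Lemma val_skew_pos (j : 'I_(bigN G).+1) : skew_pos j = skew_nat j :> nat.
Proof.
apply: (@inordK (d + k)); rewrite /skew_nat.
have hm := double_half_deg.
case: ifP => hj; first by lia.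
have [|e [-> _ _]] := @even_posP (j - (half_deg d).+1).
  by have := ltn_ord j; have := bigN_even; lia.
by have := ltn_ord e; lia.
Qed.

Lemma skew_pos_l (j : 'I_(bigN G).+1) : (j <= half_deg d)%N ->
  exists p : 'I_d.+1, skew_pos j = lshift k p /\ p = (2 * j)%N :> nat.
Proof.
move=> hj; have hm := double_half_deg.
have hp : (2 * j < d.+1)%N by lia.
by exists (Ordinal hp); split=> //; apply/val_inj; rewrite /= val_skew_pos /skew_nat hj.
Qed.

Lemma skew_pos_r (j : 'I_(bigN G).+1) : (half_deg d < j)%N ->
  exists e : 'I_k, [/\ skew_pos j = rshift d.+1 e, weight_even G e
    & (j - (half_deg d).+1)%N = index e (enum EV)].
Proof.
move=> hj; have [|e [h1 h2 h3]] := @even_posP (j - (half_deg d).+1).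
  by have := ltn_ord j; have := bigN_even; lia.
exists e; split=> //; apply/val_inj; rewrite /= val_skew_pos /skew_nat leqNgt hj /= h1.
by rewrite addnS addSn.
Qed.

Lemma skew_pos_inj : injective skew_pos.
Proof.
move=> j j' e; apply/val_inj => /=.
case: (leqP j (half_deg d)) => [/skew_pos_l [p [e1 h1]]|hj];
  case: (leqP j' (half_deg d)) => [/skew_pos_l [p' [e2 h2]]|hj'].
- by move: e; rewrite e1 e2 => /lshift_inj pp; move: h1; rewrite pp h2; lia.
- have [f [e2 _ _]] := skew_pos_r hj'; move: e; rewrite e1 e2.
  by move=> /eqP; rewrite eq_lrshift.
- have [f [e1 _ _]] := skew_pos_r hj; move: e; rewrite e1 e2.
  by move=> /eqP; rewrite eq_rlshift.
- have [f [e1 _ i1]] := skew_pos_r hj; have [f' [e2 _ i2]] := skew_pos_r hj'.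
  by move: e; rewrite e1 e2 => /rshift_inj ff; move: i1 i2; rewrite ff; lia.
Qed.

Lemma skew_posP i : skew_index i <-> exists j, skew_pos j = i.
Proof.
split=> [|[j <-]]; last first.
  case: (leqP j (half_deg d)) => [/skew_pos_l [p [-> h]]|/skew_pos_r [e [-> h _]]].
    by rewrite skew_index_l h mul2n odd_double.
  by rewrite skew_index_r; apply/asboolP.
case: (split_ordP i) => j ->.
  rewrite skew_index_l => ev; have jE := odd_double_half j; rewrite (negbTE ev) add0n in jE.
  have hj : (j./2 <= half_deg d)%N by apply: half_leq; rewrite -ltnS.
  have hb : (j./2 < (bigN G).+1)%N by have := bigN_even; lia.
  have [p [e h]] := @skew_pos_l (Ordinal hb) hj.
  exists (Ordinal hb); rewrite e; congr lshift; apply/val_inj.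
  by rewrite /= h /= mul2n.
rewrite skew_index_r => /asboolP ev.
have hi : (index j (enum EV) < #|EV|)%N.
  by rewrite cardE index_mem mem_enum inE; apply/asboolP.
have hb : ((half_deg d).+1 + index j (enum EV) < (bigN G).+1)%N by have := bigN_even; lia.
have [|e [e_eq ev' h]] := @skew_pos_r (Ordinal hb); first by rewrite /= leq_addr.
exists (Ordinal hb); rewrite e_eq; congr rshift.
have je : j \in enum EV by rewrite mem_enum inE; apply/asboolP.
have ee : e \in enum EV by rewrite mem_enum inE; apply/asboolP.
by rewrite -(nth_index j ee) -h /= addKn nth_index.
Qed.

End Translation.

(** * The structured backward error *)

Section Main.
Variables (R : realType) (n d k : nat) (G : rmp R n d k) (lam : R[i]).
Local Notation C := R[i].
Local Notation s := (d.+1 + k)%N.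
Local Notation L := (Lam G lam).
Local Notation M := (Mmx G lam).
Local Notation iota := (@skew_pos R n d k G).
Local Notation P := (pencil L M iota).
Local Notation B := (solve_mx L M).
Local Notation E := (blk n).

Lemma Jmx_blk : Jmx G lam = Defs.adjmx B *m B.
Proof.
rewrite /Jmx tensmx_blk /solve_mx.
have -> : Defs.adjmx (M *m lincomb_mx n L) = \sum_i (L i)^* *: ((E i)^T *m Defs.adjmx M).
  rewrite /Defs.adjmx cmxM trmx_mul /lincomb_mx.
  have -> : (cmx (\sum_i L i *: E i))^T = \sum_i (L i)^* *: (E i)^T.
    apply/matrixP => a b; rewrite !mxE !summxE conj_sum; apply: eq_bigr => i _.
    by rewrite !mxE conjM conjc_nat.
  by rewrite mulmx_suml; apply: eq_bigr => i _; rewrite -scalemxAl.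
rewrite mulmx_suml; apply: eq_bigr => i _; rewrite /lincomb_mx !mulmx_sumr.
apply: eq_bigr => j _.
have -> : (Defs.adjmx (Lambda G lam) *m Lambda G lam) i j = (L i)^* * L j.
  by rewrite mxE big_ord1 /Defs.adjmx mxE mxE.
by rewrite -!scalemxAr -scalemxAl scalerA mulrC !mulmxA.
Qed.

(** The complex coefficients of [f] encoded by the real parameters. *)
Definition zcoord (t : 'I_(2 * bigN G).+1 -> R) (j : 'I_(bigN G).+1) : C :=
  if (j < bigN G)%N then t (inord (2 * j)) +i* t (inord (2 * j + 1))
  else (t (inord (2 * bigN G)))%:C.

Lemma zcoord_surj z : complex.Im (z ord_max) = 0 -> exists t, zcoord t = z.
Proof.
move=> hz; exists (fun i => let w := z (inord i./2) in
  if odd i then complex.Im w else complex.Re w).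
apply/funext => j; rewrite /zcoord; case: ifP => hj.
  rewrite !inordK; try by have := ltn_ord j; lia.
  rewrite addn1 /= mul2n odd_double /= doubleK uphalf_double inord_val.
  by case: (z j).
have -> : j = ord_max by apply/val_inj => /=; have := ltn_ord j; lia.
rewrite inordK // mul2n odd_double doubleK.
have -> : inord (bigN G) = ord_max :> 'I_(bigN G).+1.
  by apply/val_inj; rewrite /= inordK.
by move: hz; case: (z ord_max) => a b /= ->.
Qed.

Lemma dot_skew m (A : 'M[C]_m) x : A^T = - A -> dot x (A *m x) = 0.
Proof.
move=> h; have : dot x (A *m x) = - dot x (A *m x).
  by rewrite {1}dot_mulmx h mulNmx dotNl dotC.
by move/eqP; rewrite -addr_eq0 -mulr2n mulrn_eq0 /= => /eqP.
Qed.

Hypotheses (hw : forall j, weight G j lam <> 0) (hG : T_odd G).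

Let hpar : forall j, weight_even G j \/ weight_odd G j. Proof. by case: hG. Qed.
Let s_gt0 : (0 < s)%N. Proof. by []. Qed.
Let skewP i : skew_index G i <-> exists j, iota j = i.
Proof. exact: skew_posP hw hpar i. Qed.

Lemma Cmx_blk (j : 'I_(bigN G).+1) : Cmx G lam j = B^T *m E (iota j).
Proof.
have key : ((Lambda G lam)^T *m (delta_mx (iota j) 0 : 'cV[C]_s)^T) *t M^T
    = B^T *m E (iota j).
  rewrite tensmx_blk /solve_mx trmx_mul /lincomb_mx linear_sum mulmx_suml mulmx_suml.
  apply: eq_bigr => i _; rewrite (bigD1 (iota j)) //= big1 => [|i' ne].
    rewrite addr0 mxE big_ord1 mxE [X in _ * X]mxE [X in _ * X]mxE !eqxx mulr1 -/(L i).
    by rewrite linearZ /= -!scalemxAl.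
  by rewrite mxE big_ord1 [X in _ * X]mxE [X in _ * X]mxE (negbTE ne) mulr0 scale0r.
rewrite -key /Cmx.
have uv p : p = (skew_nat G j).+1 -> unit_vec R d k p = delta_mx (iota j) 0.
  move=> ->; apply/matrixP => a b; rewrite !mxE (ord1 b) andbT eqSS.
  by rewrite -(val_skew_pos hw hpar j) -val_eqE.
by case: ifP => hj; rewrite uv // /skew_nat hj ?addn1 // addSn; congr ((_ + _).+1);
  rewrite /even_index /even_pos; congr nth; lia.
Qed.

Lemma Fmx_pencil t : Fmx lam t = P (zcoord t).
Proof.
have e : fmx lam t = multiplier_mx L M iota (zcoord t).
  rewrite /fmx /multiplier_mx big_ord_recr /= big_mkord.
  have S (j : 'I_(bigN G).+1) : Smx G lam j = constraint_mx L M (iota j).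
    by rewrite /Smx Cmx_blk /constraint_mx; move: (solve_mx _ _) => B0; rewrite trmx_mul trmxK.
  rewrite {2}/zcoord /= ltnn -(S ord_max); congr (_ + _); apply: eq_bigr => j _.
  by rewrite /zcoord /= ltn_ord -(S (widen_ord (leqnSn _) j)).
by rewrite /Fmx Jmx_blk e.
Qed.

Definition stack D (x : 'cV[C]_n) : 'cV[C]_(s * n) := glue (fun i => coef D i *m x).

Lemma lincomb_mx_stack D x : lincomb_mx n L *m stack D x = weighted_sum G D lam *m x.
Proof.
rewrite lincomb_mx_mulmx weighted_sum_coef mulmx_suml; apply: eq_bigr => i _.
by rewrite blk_glue scalemxAl.
Qed.

Hypothesis hM : rmp_eval G lam \in unitmx.

(** If every coefficient is skew then so is [G(lam)]. *)
Lemma Mskew : (forall i, exists j, iota j = i) -> M^T = - M.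
Proof.
move=> surj.
have hGT : (rmp_eval G lam)^T = - rmp_eval G lam.
  rewrite /rmp_eval weighted_sum_coef linear_sum -sumrN; apply: eq_bigr => i _.
  rewrite linearZ /= (oddT_setP hw hpar _).1; last by case: hG.
  by rewrite ifT ?scalerN //; apply/skewP.
have h1 : M^T *m rmp_eval G lam = - 1%:M.
  rewrite -[X in _ *m X]opprK -hGT mulmxN -trmx_mul.
  by rewrite /Mmx mulmxV // trmx1.
by rewrite -[LHS](mulmxK hM) h1 mulNmx mul1mx.
Qed.

Lemma stack_feasible D x : oddT_set G D ->
  weighted_sum G D lam *m x = rmp_eval G lam *m x ->
  B *m stack D x = x /\ feasible L M iota (stack D x).
Proof.
move=> hD e; have Bx : B *m stack D x = x.
  by rewrite /solve_mx -mulmxA lincomb_mx_stack e mulKmx.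
split=> // j; rewrite Bx blk_glue dot_skew //.
rewrite ((oddT_setP hw hpar _).1 hD) ifT //; apply/skewP; by exists j.
Qed.

Hypothesis n_gt0 : (0 < n)%N.

Lemma stack_bound D x z : oddT_set G D -> x != 0 ->
  weighted_sum G D lam *m x = rmp_eval G lam *m x ->
  0 < sqn (stack D x) /\ sqn x / sqn (stack D x) <= lambda2 (P z).
Proof.
move=> hD x0 e; have [Bx fv] := stack_feasible hD e.
have v0 : stack D x != 0 by apply: contra x0 => /eqP h; rewrite -Bx h mulmx0.
by split; [rewrite sqn_gt0 | rewrite -{1}Bx; apply: feasible_le].
Qed.

(** [Delta = G] is an admissible perturbation, and any [x <> 0] then gives a feasible
stack. *)
Lemma lambda2_pencil_gt0 z : 0 < lambda2 (P z).
Proof.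
have [x x1] := unit_vector_exists R n_gt0.
have x0 : x != 0 by rewrite -sqn_gt0 x1 ltr01.
have [h1 h2] := @stack_bound (rmp_coefs G) x z (proj2 hG) x0 erefl.
by apply: lt_le_trans h2; rewrite divr_gt0 // sqn_gt0.
Qed.

Lemma tuple_norm_lower D z : oddT_set G D ->
  \det (weighted_sum G (coefs_sub (rmp_coefs G) D) lam) = 0 ->
  1 / Num.sqrt (lambda2 (P z)) <= tuple_norm D.
Proof.
move=> hD /eqP; rewrite -det_tr => /det0P [y y0 hy].
pose x := y^T; have x0 : x != 0 by rewrite trmx_eq0.
have hx : weighted_sum G D lam *m x = rmp_eval G lam *m x.
  apply/eqP; rewrite eq_sym -subr_eq0 -mulmxBl -weighted_sum_sub.
  by rewrite -[_ *m _]trmxK trmx_mul trmxK hy trmx0.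
have [sv hl] := stack_bound z hD x0 hx.
have l0 := lambda2_pencil_gt0 z; set l := lambda2 _ in hl l0 *.
have sx : 0 < sqn x by rewrite sqn_gt0.
pose T2 := \sum_i spectral_norm (coef D i) ^+ 2.
have sT : sqn (stack D x) <= T2 * sqn x.
  rewrite sqn_blk mulr_suml; apply: ler_sum => i _.
  by rewrite blk_glue; apply: sqn_mulmx_le.
have T20 : 0 <= T2 by apply: sumr_ge0 => i _; apply: sqr_ge0.
have key : 1 <= l * T2.
  have hl' : sqn x <= l * sqn (stack D x) by rewrite -ler_pdivrMr.
  suff : 1 * sqn x <= l * T2 * sqn x by rewrite ler_pM2r.
  rewrite mul1r -mulrA.
  by apply: le_trans hl' _; rewrite ler_pM2l.
rewrite tuple_norm_coef -/T2 ler_pdivrMr ?sqrtr_gt0 // -sqrtrM //.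
by rewrite -[leLHS]sqrtr1 ler_wsqrtr // mulrC.
Qed.

(** The minimal mappings realise every block of a feasible [v] at the cost
[|v_i| / |x|]. *)
Lemma tuple_from_feasible v l : 0 < l -> v != 0 -> feasible L M iota v ->
  sqn (B *m v) = l * sqn v -> exists D, [/\ oddT_set G D,
    \det (weighted_sum G (coefs_sub (rmp_coefs G) D) lam) = 0
    & tuple_norm D <= 1 / Num.sqrt l].
Proof.
move=> l0 v0 fv e; set x := B *m v in e.
have sv : 0 < sqn v by rewrite sqn_gt0.
have sx : 0 < sqn x by rewrite e mulr_gt0.
have x0 : x != 0 by rewrite -sqn_gt0.
have hS i : exists S : 'M[C]_n, [/\ S^T = (if skew_index G i then - S else S),
    S *m x = E i *m v & forall a, sqn (S *m a) <= sqn (E i *m v) / sqn x * sqn a].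
  case hi: (skew_index G i); last exact: sym_mapping.
  by have [j <-] := (skewP i).1 hi; apply: skew_mapping.
have [S hS'] := choice hS.
pose D : coefs R n d k := (fun p => S (lshift k p), fun j => S (rshift d.+1 j)).
have DS i : coef D i = S i.
  by case: (split_ordP i) => j ->; rewrite ?coef_l ?coef_r.
exists D; split.
- by apply/(oddT_setP hw hpar) => i; rewrite DS; case: (hS' i).
- apply/eqP; rewrite -det_tr; apply/det0P; exists x^T; first by rewrite trmx_eq0.
  rewrite -trmx_mul weighted_sum_sub mulmxBl.
  have -> : weighted_sum G D lam *m x = lincomb_mx n L *m v.
    rewrite lincomb_mx_mulmx weighted_sum_coef mulmx_suml; apply: eq_bigr => i _.
    by rewrite DS -scalemxAl; case: (hS' i) => _ -> _.
  rewrite /x /solve_mx -mulmxA mulKVmx //; first by rewrite subrr trmx0.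
- rewrite tuple_norm_coef div1r -(sqrtrV (ltW l0)); apply: ler_wsqrtr.
  apply: (@le_trans _ _ (\sum_i sqn (E i *m v) / sqn x)).
    apply: ler_sum => i _; rewrite DS.
    have q0 : 0 <= sqn (E i *m v) / sqn x by rewrite divr_ge0 ?sqn_ge0.
    rewrite -[leRHS]sqr_sqrtr // ler_sqr ?nnegrE ?sqrtr_ge0 ?spectral_norm_ge0 //.
    apply: spectral_norm_le; rewrite ?sqrtr_ge0 // => y.
    by rewrite sqr_sqrtr //; case: (hS' i).
  rewrite -mulr_suml -sqn_blk e le_eqVlt; apply/orP; left; apply/eqP.
  by field; rewrite !lt0r_neq0.
Qed.

End Main.

Theorem theorem4p2 (R : realType) (n d k : nat) (G : rmp R n d k) (lam : R[i])
    (hn : (0 < n)%N)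
    (hG : T_odd G)
    (hlam : lam <> 0)
    (hpole : ~ is_pole G lam)
    (hw : forall j : 'I_k, weight G j lam <> 0)
    (hM : rmp_eval G lam \in unitmx) :
  exists lhat : R,
    [/\ (exists that : 'I_(2 * bigN G).+1 -> R, psi lam that = lhat),
        (forall t : 'I_(2 * bigN G).+1 -> R, lhat <= psi lam t),
        0 < lhat,
        ((1 / Num.sqrt lhat)%:E <= eta_oddT G lam)%E
      & forall that : 'I_(2 * bigN G).+1 -> R,
          psi lam that = lhat ->
          simple_eigenvalue (Fmx lam that) lhat%:C ->
          eta_oddT G lam = (1 / Num.sqrt lhat)%:E].
Proof.
have hpar : forall j, weight_even G j \/ weight_odd G j by case: hG.
have s_gt0 : (0 < d.+1 + k)%N by [].
pose P := pencil (Lam G lam) (Mmx G lam) (skew_pos (G := G)).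
have psiE t : psi lam t = lambda2 (P (zcoord t)).
  by rewrite /psi (Fmx_pencil hw hG).
have Mu : Mmx G lam \in unitmx by rewrite unitmx_inv.
have [z0 hz0] := pencil_min hn s_gt0 (skew_pos_inj hw hpar) (Lam_neq0 hlam hw) Mu
  (Mskew hw hG hM).
(* A phase moves the complex minimiser to one whose last coordinate is real. *)
have [th th1 hth] := phase_exists (z0 ord_max).
have [t0 ht0] : exists t0, zcoord t0 = fun j => th * z0 j.
  by apply: zcoord_surj; rewrite hth.
have [lhat lE] : exists l, l = lambda2 (P z0) by exists (lambda2 (P z0)).
have lmin z : lhat <= lambda2 (P z) by rewrite lE; exact: hz0.
have e0 : psi lam t0 = lhat.
  apply/le_anti/andP; split; last by rewrite psiE; exact: lmin.
  by rewrite psiE ht0 lE; exact: pencil_rotate.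
have l0 : 0 < lhat by rewrite lE; exact: lambda2_pencil_gt0.
have low : ((1 / Num.sqrt lhat)%:E <= eta_oddT G lam)%E.
  apply: le_ereal_inf_tmp => _ [D [hD hdet] <-]; rewrite lee_fin lE.
  exact: (tuple_norm_lower hw hG hM hn z0 hD hdet).
exists lhat; split.
- by exists t0.
- by move=> t; rewrite psiE; exact: lmin.
- exact: l0.
- exact: low.
move=> t; rewrite psiE (Fmx_pencil hw hG) => et simple.
apply/le_anti; rewrite low andbT.
have tmin z' : lambda2 (P (zcoord t)) <= lambda2 (P z') by rewrite et; exact: lmin.
rewrite -et in simple.
have [v [v0 fv ev]] := optimal_feasible hn s_gt0 tmin simple; rewrite et in ev.
have [D [hD hdet hT]] := tuple_from_feasible hw hG hM hn l0 v0 fv ev.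
apply: (@le_trans _ _ (tuple_norm D)%:E); last by rewrite lee_fin.
by apply: ereal_inf_lbound; exists D.
Qed.
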